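(* Let $\mathcal{A}$ be an essential arrangement of projective planes in $\mathbb{P}^3(\mathbb{R})$, and let $(f_0,f_1,f_2,f_3)$ be the $f$-vector of the cell decomposition of $\mathbb{P}^3(\mathbb{R})$ induced by $\mathcal{A}$. Then the following conditions are equivalent: 1. $\mathcal{A}$ is simplicial; 2. $f_2=2f_3$; 3. $2f_0-2f_1+f_2=0$.
   Context: An arrangement $\mathcal{A}$ in $\mathbb{P}^3(\mathbb{R})=\mathbb{P}(V)$, $V$ a 4-dimensional real vector space, is a finite set of distinct projective planes $H=\mathbb{P}(\ker a_H)$, $a_H\in V^*\setminus\{0\}$. It is essential if the covectors $a_H$ span $V^*$. A chamber is a connected component of the complement of $\bigcup_{H\in\mathcal{A}}H$. An essential arrangement is simplicial if the closure of every chamber is combinatorially a tetrahedron; equivalently, every chamber has exactly four facets. The arrangement induces a cell decomposition of $\mathbb{P}^3(\mathbb{R})$: the $i$-dimensional cells are the connected components of $X\setminus\bigcup_{H\in\mathcal{A},\,X\not\subset H}H$, where $X$ runs over the $i$-dimensional projective flats of $\mathcal{A}$ (intersections of planes of $\mathcal{A}$, including $\mathbb{P}^3(\mathbb{R})$ itself for $i=3$). Here $f_i$ is the number of $i$-dimensional cells; in particular $f_3$ is the number of chambers. *)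

(* Defs.v *)
From mathcomp Require Export all_boot all_order all_algebra generic_quotient.
From mathcomp Require Export finmap.
From mathcomp Require Export all_classical all_reals.
From mathcomp Require Export topology normedtype.

Set Implicit Arguments.
Unset Strict Implicit.
Unset Printing Implicit Defensive.

Import GRing.Theory Num.Theory.
Import numFieldNormedType.Exports.

Local Open Scope classical_set_scope.
Local Open Scope ring_scope.
Local Open Scope quotient_scope.

Notation vec R := 'rV[R]_4.
Notation covec R := 'Hom('rV[R]_4, R^o).

(* P^3(R) is the quotient of R^4 \ {0} (with the topology induced from R^4) by
   the relation "spanning the same line", with the quotient topology. *)
Definition nonzero (R : realType) : set (vec R) := [set v | v != 0].
Arguments nonzero : clear implicits.

Definition same_line (R : realType) (u v : nonzero R) : bool :=
  (<[set_val u]> == <[set_val v]>)%VS.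

Lemma same_line_equiv (R : realType) : equiv_class_of (@same_line R).
Proof.
split=> [u|u v|v u w]; rewrite /same_line; [exact: eqxx|exact: eq_sym|].
by move=> /eqP-> /eqP->.
Qed.

Canonical same_line_equiv_rel (R : realType) :=
  EquivRelPack (same_line_equiv R).

Definition P3 (R : realType) : topologicalType :=
  quotient_topology {eq_quot (same_line_equiv_rel R)}.

Definition to_P3 (R : realType) (v : nonzero R) : P3 R :=
  \pi_{eq_quot (same_line_equiv_rel R)} v.

Definition projective (R : realType) (U : {vspace vec R}) : set (P3 R) :=
  [set to_P3 v | v in [set v : nonzero R | set_val v \in U]].

Definition components (T : topologicalType) (S : set T) : set (set T) :=
  [set connected_component S x | x in S].

(* The list A holds one covector a_H for each plane H = P(ker a_H). *)
Definition is_arrangement (R : realType) (A : seq (covec R)) : Prop :=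
  0 \notin A /\ uniq [seq lker a | a <- A].

Definition essential (R : realType) (A : seq (covec R)) : Prop :=
  (<<A>> = fullv)%VS.

(* X is the linear subspace over an i-dimensional projective flat; the empty
   family B gives the whole of P^3(R). *)
Definition flat (R : realType) (A : seq (covec R)) (i : nat)
    (X : {vspace vec R}) : Prop :=
  \dim X = i.+1 /\
  exists2 B : seq (covec R), {subset B <= A} & X = (\bigcap_(a <- B) lker a)%VS.

Definition cells (R : realType) (A : seq (covec R)) (i : nat) :
    set (set (P3 R)) :=
  [set C | exists2 X, flat A i X &
    components (projective X `\`
      \bigcup_(a in [set a | a \in A /\ ~~ (X <= lker a)%VS])
        projective (lker a)) C].

Definition f_vector (R : realType) (A : seq (covec R)) (i : nat) : nat :=
  #|` fset_set (cells A i)|.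

Definition chambers (R : realType) (A : seq (covec R)) : set (set (P3 R)) :=
  components (~` \bigcup_(a in [set a | a \in A]) projective (lker a)).

Definition faces (R : realType) (A : seq (covec R)) (C : set (P3 R)) :
    set (set (P3 R)) :=
  [set F | (exists i, cells A i F) /\ F `<=` closure C].

(* The nonempty faces of a tetrahedron, itself included, ordered by inclusion
   of their closures, are the nonempty subsets of its set of four vertices. *)
Definition combinatorial_tetrahedron (R : realType) (A : seq (covec R))
    (C : set (P3 R)) : Prop :=
  exists2 phi : set (P3 R) -> {set 'I_4},
    set_bij (faces A C) [set S | S != finset.set0] phi &
    forall F G, faces A C F -> faces A C G ->
      (closure F `<=` closure G <-> phi F \subset phi G).

Definition simplicial (R : realType) (A : seq (covec R)) : Prop :=
  forall C, chambers A C -> combinatorial_tetrahedron A C.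

(* Main.v *)
(** The cells of P^3 are the images of the cones of R^4 on which every covector
    has a constant sign; a cell of dimension k comes from exactly two opposite
    sign vectors, whose common zero space has dimension k + 1.

    The Euler relation f0 - f1 + f2 - f3 = 0, which yields (2) <-> (3), is the
    case of an essential arrangement in the identity "the sum of (-1)^dim over
    all the cones is 1", proved by adding the hyperplanes one at a time.

    For (1) <-> (2), a chamber is cut out by its walls, and the covectors of its
    walls have no common zero, so that it has at least four of them; each 2-cell
    is a wall of exactly two chambers, whence 2 f2 >= 4 f3, with equality iff
    every chamber has exactly four walls. A chamber with four walls is a
    simplicial cone, whose faces are determined by the walls which do not
    contain them; conversely the facets of a combinatorial tetrahedron
    correspond to the coatoms of the poset of subsets of 'I_4. *)
From HB Require Import structures.
Require Import Defs.
From mathcomp Require Import all_boot all_order all_algebra.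
From mathcomp Require Import zify lra.
From mathcomp Require Import finmap all_classical all_reals topology normedtype.

Set Implicit Arguments.
Unset Strict Implicit.
Unset Printing Implicit Defensive.

Import Order.TTheory GRing.Theory Num.Theory.
Import numFieldNormedType.Exports.

Local Open Scope ring_scope.

(** * Signs and sign vectors *)

(* Signs live in 'Z_3 so that they form a finite type with an opposite. *)
Definition sg3 (R : realType) (x : R) : 'Z_3 :=
  if x == 0 then 0 else if 0 < x then 1 else -1.

Section Sg3.
Variable R : realType.
Implicit Types x y k : R.

Lemma sg3_eq0 x : (sg3 x == 0) = (x == 0).
Proof. by rewrite /sg3; case: (ltgtP 0 x). Qed.

Lemma sg3_0 : sg3 (0 : R) = 0.
Proof. by apply/eqP; rewrite sg3_eq0. Qed.

Lemma sg3_eq1 x : (sg3 x == 1) = (0 < x).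
Proof. by rewrite /sg3; case: (ltgtP 0 x). Qed.

Lemma sg3_eqN1 x : (sg3 x == -1) = (x < 0).
Proof. by rewrite /sg3; case: (ltgtP 0 x). Qed.

Lemma sg3_gt0 x : 0 < x -> sg3 x = 1.
Proof. by move=> ?; apply/eqP; rewrite sg3_eq1. Qed.

Lemma sg3_lt0 x : x < 0 -> sg3 x = -1.
Proof. by move=> ?; apply/eqP; rewrite sg3_eqN1. Qed.

Lemma sg3N x : sg3 (- x) = - sg3 x.
Proof.
by rewrite /sg3 oppr_eq0 oppr_gt0; case: (ltgtP 0 x); rewrite ?oppr0 ?opprK.
Qed.

Lemma sg3M_gt0 k x : 0 < k -> sg3 (k * x) = sg3 x.
Proof. by move=> k0; rewrite /sg3 mulf_eq0 gt_eqF//= pmulr_rgt0. Qed.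

Lemma sg3M_lt0 k x : k < 0 -> sg3 (k * x) = - sg3 x.
Proof.
by move=> k0; rewrite -[k]opprK mulNr sg3N sg3M_gt0// oppr_gt0.
Qed.

Lemma sg3D x y : (sg3 x == 0) || (sg3 x == sg3 y) -> sg3 (x + y) = sg3 y.
Proof.
rewrite /sg3; case: (ltgtP 0 x) => // [x0|x0|<-]; last by rewrite add0r.
- case: (ltgtP 0 y) => // y0 _.
  by case: (ltgtP 0 (x + y)) => // ?; exfalso; lra.
- case: (ltgtP 0 y) => // y0 _.
  by case: (ltgtP 0 (x + y)) => // ?; exfalso; lra.
Qed.

Lemma perturb_exists (n : nat) (u v : 'I_n -> R) :
  exists2 e : R, 0 < e &
    forall i, u i != 0 -> sg3 (u i + e * v i) = sg3 (u i).
Proof.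
(* Any [e] below every [r i] makes [e * v i] smaller than [u i] in absolute value; the 1 keeps the
   denominator positive. *)
pose r i := `|u i| / (1 + `|v i|).
have [e e0 eP] : exists2 e : R, 0 < e & forall i, u i != 0 -> e < r i.
  (* The initial value 1 serves an empty family; halving makes the bound strict. *)
  exists (\big[Order.min/1]_(i | u i != 0) (r i / 2)).
    elim/big_ind: _ => // [x y x0 y0|i ui]; first by rewrite lt_min x0.
    by rewrite !divr_gt0 ?normr_gt0// ltr_pwDl.
  move=> i ui; rewrite (bigD1 i)//= gt_min.
  suff -> : r i / 2 < r i by [].
  have : 0 < r i by rewrite divr_gt0 ?normr_gt0// ltr_pwDl.
  by lra.
exists e => // i ui; have := eP i ui; rewrite /r ltr_pdivlMr ?ltr_pwDl// => h.
have {}h : `|e * v i| < `|u i|.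
  by rewrite normrM (gtr0_norm e0); move: h; rewrite mulrDr mulr1; lra.
rewrite /sg3 (negPf ui); move: h ui.
case: (ltrgt0P (u i)) => // u0.
- rewrite ltr_norml => /andP[h1 h2] _.
  by case: (ltgtP 0 (u i + e * v i)) => // ?; exfalso; lra.
- rewrite ltr_norml => /andP[h1 h2] _.
  by case: (ltgtP 0 (u i + e * v i)) => // ?; exfalso; lra.
Qed.

End Sg3.

Lemma Z3_cases (s : 'Z_3) : [\/ s = 0, s = 1 | s = -1].
Proof.
case: s => [[|[|[|//]]] h]; [constructor 1|constructor 2|constructor 3];
  exact: val_inj.
Qed.

Lemma Z3_neq0 (s : 'Z_3) : s != 0 -> s = 1 \/ s = -1.
Proof. by case: (Z3_cases s) => ->; [|left|right]. Qed.

Lemma Z3_eq_opp (s : 'Z_3) : (s == - s) = (s == 0).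
Proof. by case: (Z3_cases s) => ->. Qed.

Notation signs n := {ffun 'I_n -> 'Z_3}.

Definition sv (R : realType) n (c : 'I_n -> covec R) (x : vec R) : signs n :=
  [ffun i => sg3 (c i x)].

Definition realizable (R : realType) n (c : 'I_n -> covec R) (s : signs n) :
  bool := `[< exists x, sv c x = s >].

(** For a realizable [s] this is the linear span of its cone, so its dimension is that of the
    cone. *)
Definition zflat (R : realType) n (c : 'I_n -> covec R) (s : signs n) :
  {vspace vec R} := (\bigcap_(i | s i == 0%R) lker (c i))%VS.

Definition flip n (s : signs n) (b : 'I_n) (t : 'Z_3) : signs n :=
  [ffun i => if i == b then t else s i].

(** For a chamber [s], the hyperplane [b] carries a facet when some point lies on it and on the same
    side as the chamber for all the other covectors. *)
Definition walls (R : realType) n (c : 'I_n -> covec R) (s : signs n) :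
  {set 'I_n} := [set b | realizable c (flip s b 0)]%SET.

Section SignVectors.
Variables (R : realType) (n : nat) (c : 'I_n -> covec R).
Implicit Types (s t : signs n) (x y w : vec R).

Lemma realizableP s : reflect (exists x, sv c x = s) (realizable c s).
Proof. exact: asboolP. Qed.

Lemma realizable_sv x : realizable c (sv c x).
Proof. by apply/realizableP; exists x. Qed.

Lemma sv_eq0 x i : (sv c x i == 0) = (c i x == 0).
Proof. by rewrite ffunE sg3_eq0. Qed.

Lemma sv_eq x s : (forall i, sg3 (c i x) = s i) -> sv c x = s.
Proof. by move=> h; apply/ffunP => i; rewrite ffunE. Qed.

Lemma sv0 : sv c 0 = 0.
Proof. by apply: sv_eq => i; rewrite linear0 sg3_0 ffunE. Qed.

Lemma svZ_gt0 (k : R) x : 0 < k -> sv c (k *: x) = sv c x.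
Proof. by move=> k0; apply: sv_eq => i; rewrite ffunE linearZ sg3M_gt0. Qed.

Lemma svZ_lt0 (k : R) x : k < 0 -> sv c (k *: x) = - sv c x.
Proof. by move=> k0; apply: sv_eq => i; rewrite !ffunE linearZ sg3M_lt0. Qed.

Lemma svN x : sv c (- x) = - sv c x.
Proof. by rewrite -scaleN1r svZ_lt0// oppr_lt0. Qed.

Lemma realizableN s : realizable c (- s) = realizable c s.
Proof.
by apply/realizableP/realizableP => -[x sx]; exists (- x);
  rewrite svN sx ?opprK.
Qed.

Lemma mem_zflat s x :
  reflect (forall i, s i == 0 -> c i x = 0) (x \in zflat c s).
Proof.
rewrite /zflat; apply: (iffP idP) => [xs i si|h].
  have /subvP/(_ _ xs) : (\bigcap_(i | s i == 0%R) lker (c i) <= lker (c i))%VS.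
    exact: bigcapv_inf (subvv _).
  by rewrite memv_ker => /eqP.
rewrite -[x]/x memvE; apply/subv_bigcapP => i /h cx.
by rewrite -memvE memv_ker cx.
Qed.

Lemma mem_zflat_sv x : x \in zflat c (sv c x).
Proof. by apply/mem_zflat => i; rewrite sv_eq0 => /eqP. Qed.

Lemma sv_perturb x w :
  exists2 e : R, 0 < e &
    forall i, c i x != 0 -> sg3 (c i (x + e *: w)) = sg3 (c i x).
Proof.
have [e e0 h] := perturb_exists (fun i => c i x : R) (fun i => c i w : R).
by exists e => // i /h; rewrite linearD linearZ.
Qed.

Lemma sv_perturb_flat x w : w \in zflat c (sv c x) ->
  exists2 e : R, 0 < e & sv c (x + e *: w) = sv c x.
Proof.
move=> /mem_zflat wx; have [e e0 h] := sv_perturb x w.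
exists e => //; apply: sv_eq => i; rewrite ffunE.
have [cx|cx] := eqVneq (c i x) 0; last exact: h.
by rewrite linearD linearZ/= wx ?sv_eq0 ?cx// scaler0 addr0.
Qed.

(** The hypothesis puts [x] in the closure of the cone of [y]; moving from there in the direction
    [y] enters that cone at once. *)
Lemma sv_addZ (k : R) x y : 0 < k ->
    (forall i, (sv c x i == 0) || (sv c x i == sv c y i)) ->
  sv c (x + k *: y) = sv c y.
Proof.
move=> k0 h; apply: sv_eq => i; rewrite linearD linearZ/=.
have := h i; rewrite !ffunE => hi; rewrite sg3D sg3M_gt0//.
Qed.

Lemma dim_cap_lker (X : {vspace vec R}) (a : covec R) :
  ~~ (X <= lker a)%VS -> (\dim X = (\dim (lker a :&: X)).+1)%N.
Proof.
move=> Xa; have := limg_ker_dim a X; rewrite capvC => <-.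
suff -> : \dim (a @: X) = 1%N by rewrite addn1.
apply/eqP; rewrite eqn_leq; apply/andP; split.
  by have := dimvS (subvf (a @: X)); rewrite dimvf.
by rewrite lt0n dimv_eq0; apply: contraNneq Xa => aX; rewrite lkerE aX.
Qed.

Lemma fullvN_lker (a : covec R) : a != 0 -> ~~ (fullv <= lker a)%VS.
Proof.
apply: contra => /subvP af; apply/eqP/lfunP => x.
by rewrite zero_lfunE; apply/eqP; rewrite -memv_ker af// memvf.
Qed.

Lemma dim_lker (a : covec R) : a != 0 -> \dim (lker a) = 3%N.
Proof.
by move=> /fullvN_lker/dim_cap_lker; rewrite capvf dimvf => -[<-].
Qed.

End SignVectors.

(** * Euler relation for the cones of a central arrangement *)

Section Euler.
Variable R : realType.

Definition fcons n (u : 'Z_3) (s : signs n) : signs n.+1 :=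
  [ffun i => if unlift ord0 i is Some j then s j else u].

Lemma fcons0 n u (s : signs n) : fcons u s ord0 = u.
Proof. by rewrite ffunE unlift_none. Qed.

Lemma fconsS n u (s : signs n) j : fcons u s (lift ord0 j) = s j.
Proof. by rewrite ffunE liftK. Qed.

Lemma sv_fcons n (c : 'I_n.+1 -> covec R) x :
  sv c x = fcons (sg3 (c ord0 x)) (sv (fun j => c (lift ord0 j)) x).
Proof.
apply: sv_eq => i; case: (unliftP ord0 i) => [j ->|->].
  by rewrite fconsS ffunE.
by rewrite fcons0.
Qed.

Lemma fcons_inj n u (s : signs n) u' s' :
  fcons u s = fcons u' s' -> u = u' /\ s = s'.
Proof.
move=> /ffunP h; split; first by have := h ord0; rewrite !fcons0.
by apply/ffunP => j; have := h (lift ord0 j); rewrite !fconsS.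
Qed.

Lemma zflat_fcons n (c : 'I_n.+1 -> covec R) u s :
  zflat c (fcons u s) =
    (if u == 0%R then lker (c ord0) :&: zflat (fun j => c (lift ord0 j)) s
     else zflat (fun j => c (lift ord0 j)) s)%VS.
Proof.
rewrite [LHS]/zflat big_mkcond big_ord_recl fcons0.
rewrite (_ : bigop.body _ _ _ = zflat (fun j => c (lift ord0 j)) s); last first.
  by rewrite /zflat [RHS]big_mkcond; apply: eq_bigr => j _; rewrite fconsS.
by case: (u == 0); rewrite /= ?capfv.
Qed.

Lemma sum_Z3 (F : 'Z_3 -> int) : \sum_u F u = F 0 + F 1 + F (-1).
Proof.
rewrite (bigD1 0)//= (bigD1 1)//= (big_pred1 (-1)) ?addrA// => u /=.
by case: (Z3_cases u) => ->.
Qed.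

(* Adding the hyperplane [c ord0] splits a cell of dimension d met by it in
   three, of dimensions d, d-1, d; the alternating sum does not change. *)
Lemma euler_fiber n (c : 'I_n.+1 -> covec R) (s : signs n)
    (c' := fun j => c (lift ord0 j)) :
  \sum_(u | realizable c (fcons u s)) (-1) ^+ \dim (zflat c (fcons u s)) =
  (if realizable c' s then (-1) ^+ \dim (zflat c' s) else 0) :> int.
Proof.
rewrite big_mkcond sum_Z3 !zflat_fcons eqxx -/c'.
have [-> ->] : ((1 : 'Z_3) == 0) = false /\ ((-1 : 'Z_3) == 0) = false by [].
move: (dim_cap_lker (a := c ord0) (X := zflat c' s)).
set X := zflat c' s; set d := \dim X; set d' := \dim (_ :&: _) => dimXE.
have rE u : realizable c (fcons u s) =
    `[< exists2 x, sv c' x = s & sg3 (c ord0 x) = u >].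
  apply/realizableP/asboolP => -[x].
    by rewrite sv_fcons => /fcons_inj[]; exists x.
  by move=> xs xu; exists x; rewrite sv_fcons xu xs.
have [/realizableP[x0 x0s]|nr] := boolP (realizable c' s); last first.
  suff nru u : realizable c (fcons u s) = false by rewrite !nru.
  apply/negbTE; apply: contra nr; rewrite rE => /asboolP[x xs _].
  by apply/realizableP; exists x.
have memX x : sv c' x = s -> x \in X.
  by move=> xs; rewrite /X -xs; exact: mem_zflat_sv.
have [Xk|Xk] := boolP (X <= lker (c ord0))%VS.
  have sg0 x : sv c' x = s -> sg3 (c ord0 x) = 0.
    move=> /memX /(subvP Xk); rewrite memv_ker => /eqP->.
    by rewrite sg3_0.
  have -> : realizable c (fcons 0 s).
    by rewrite rE; apply/asboolP; exists x0 => //; exact: sg0.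
  have nr u : u != 0 -> realizable c (fcons u s) = false.
    move=> u0; apply/negbTE; rewrite rE; apply/asboolP => -[x xs].
    by rewrite sg0// => /esym/eqP; rewrite (negPf u0).
  by rewrite !nr// !addr0 /d' (capv_idPr Xk).
have [w wX cw] : exists2 w, w \in X & c ord0 w != 0.
  by move: Xk => /subvPn[w wX]; rewrite memv_ker; exists w.
have dimX := dimXE Xk.
(* If the cone meets the hyperplane at [x], moving along [w] both ways inside [X] realizes all three
   signs; scaling [w] by its own value makes the displacement a positive square up to sign. *)
have [[x xs /eqP cx0]|nz] := pselect (exists2 x, sv c' x = s & c ord0 x = 0).
  have tw (k : R) : exists2 e : R, 0 < e & sv c' (x + e *: (k *: w)) = s.
    have [|e e0 xe] := @sv_perturb_flat _ _ c' x (k *: w).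
      by rewrite xs memvZ.
    by exists e => //; rewrite xe.
  have r u : realizable c (fcons u s).
    rewrite rE; apply/asboolP; case: (Z3_cases u) => ->.
    - by exists x => //; apply/eqP; rewrite sg3_eq0.
    - have [e e0 xe] := tw (c ord0 w); exists (x + e *: (c ord0 w *: w)) => //.
      rewrite linearD !linearZ/= (eqP cx0) add0r; apply: sg3_gt0.
      by rewrite pmulr_rgt0// lt_neqAle sqr_ge0 eq_sym sqrf_eq0 cw.
    - have [e e0 xe] := tw (- c ord0 w).
      exists (x + e *: (- c ord0 w *: w)) => //.
      rewrite linearD !linearZ/= (eqP cx0) add0r; apply: sg3_lt0.
      rewrite pmulr_rlt0// /GRing.scale/= mulNr oppr_lt0.
      by rewrite lt_neqAle sqr_ge0 eq_sym sqrf_eq0 cw.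
  by rewrite !r dimX exprS mulN1r subrr add0r.
have nr0 : realizable c (fcons 0 s) = false.
  apply/negbTE; rewrite rE; apply/asboolP => -[x xs /eqP].
  by rewrite sg3_eq0 => /eqP cx; apply: nz; exists x.
(* By convexity, points on both sides would give a point of the cone on the hyperplane, namely a
   positive combination of the two. *)
have nrboth : realizable c (fcons 1 s) -> realizable c (fcons (-1) s) -> False.
  rewrite !rE => /asboolP[x xs /eqP]; rewrite sg3_eq1 => cx.
  move=> /asboolP[y ys /eqP]; rewrite sg3_eqN1 => y0.
  have k0 : 0 < - ((c ord0 y : R) / c ord0 x).
    by rewrite -mulNr divr_gt0// oppr_gt0.
  have k1 : 0 < - ((c ord0 x : R) / c ord0 y).
    by rewrite -mulrN -invrN divr_gt0// oppr_gt0.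
  apply: nz; exists (y + (- ((c ord0 y : R) / c ord0 x)) *: x).
    by rewrite sv_addZ// => i; rewrite xs ys eqxx orbT.
  rewrite linearD linearZ/= /GRing.scale/= mulNr divfK ?subrr//.
  by rewrite gt_eqF.
have rsome : realizable c (fcons 1 s) \/ realizable c (fcons (-1) s).
  have : c ord0 x0 != 0 by apply/eqP => h; apply: nz; exists x0.
  rewrite -sg3_eq0 => /Z3_neq0[h|h]; [left|right];
    by rewrite rE; apply/asboolP; exists x0.
rewrite nr0 /=.
case: (boolP (realizable c (fcons 1 s))) nrboth rsome => h1;
case: (boolP (realizable c (fcons (-1) s))) => h2 // h; rewrite ?add0r ?addr0//.
- by case: (h isT isT).
- by case.
Qed.

(** Induction on the number of covectors: sign vectors are grouped by their restriction to all
    indices but the first, and each group is summed by [euler_fiber]. With no covector only the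
    whole space is left, of even dimension 4. *)
Lemma euler n (c : 'I_n -> covec R) :
  \sum_(s | realizable c s) (-1) ^+ \dim (zflat c s) = 1 :> int.
Proof.
elim: n c => [|n IH] c.
  rewrite (big_pred1 (0 : signs 0)) => [|s]; last first.
    have -> : s = 0 by apply/ffunP => -[].
    by rewrite /= eqxx; apply/realizableP; exists 0; apply/ffunP => -[].
  by rewrite /zflat big_ord0 dimvf /dim/=.
pose h (p : 'Z_3 * signs n) := fcons p.1 p.2.
rewrite (reindex h); last first.
  apply: onW_bij.
  exists (fun s : signs n.+1 => (s ord0, [ffun j => s (lift ord0 j)])).
    move=> [u s]; rewrite /h/= fcons0; congr pair.
    by apply/ffunP => j; rewrite ffunE fconsS.
  move=> s; apply/ffunP => i; rewrite /h/=.
  by case: (unliftP ord0 i) => [j ->|->]; rewrite ?fcons0 ?fconsS ?ffunE.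
rewrite big_mkcond /= -(pair_bigA _ (fun u s =>
  if realizable c (fcons u s) then (-1) ^+ \dim (zflat c (fcons u s)) else 0)).
rewrite exchange_big/= -(IH (fun j => c (lift ord0 j))) [RHS]big_mkcond.
by apply: eq_bigr => s _; rewrite -big_mkcond euler_fiber.
Qed.

End Euler.

(** * Walls of a chamber *)

Section OpenCones.
Variables (R : realType) (n : nat) (p : 'I_n -> covec R).
Implicit Types (B : {set 'I_n}) (x y w : vec R).

Definition determines B :=
  forall x, (forall b, b \in B -> 0 < (p b x : R)) -> forall i, 0 < (p i x : R).

Definition is_wall (b : 'I_n) :=
  exists2 z, p b z = 0 & forall i, i != b -> 0 < (p i z : R).

Variable x0 : vec R.
Hypothesis x0P : forall i, 0 < (p i x0 : R).

Lemma determines_closed B : determines B ->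
  forall y, (forall b, b \in B -> 0 <= (p b y : R)) ->
  forall i, 0 <= (p i y : R).
Proof.
move=> BP y yB i; rewrite leNgt; apply/negP => yi.
(* [t] is the time at which the ray from [y] in the direction [x0] meets the hyperplane [i]; by then
   the members of [B] are already positive. *)
pose t : R := - (p i y : R) / p i x0.
have t0 : 0 < t by rewrite divr_gt0// oppr_gt0.
have /BP/(_ i) : forall b, b \in B -> 0 < (p b (y + t *: x0) : R).
  move=> b /yB yb; rewrite linearD linearZ/=.
  by rewrite ltr_wpDl// /GRing.scale/= mulr_gt0.
rewrite linearD linearZ/= /GRing.scale/= /t divfK ?subrr ?ltxx//.
by rewrite gt_eqF.
Qed.

Hypothesis p_inj : forall i j, lker (p i) = lker (p j) -> i = j.

Lemma pos_covec_neq0 i : p i != 0.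
Proof.
by apply: contraTneq (x0P i) => ->; rewrite zero_lfunE ltxx.
Qed.

(** Distinct kernels of equal dimension are not included in one another; a sign change of the
    witness does the rest. *)
Lemma separate_lker i j : i != j -> exists2 w, p i w = 0 & (p j w : R) < 0.
Proof.
move=> ij; have : ~~ (lker (p i) <= lker (p j))%VS.
  apply: contra ij => ij; apply/eqP/p_inj/eqP.
  by rewrite eqEdim ij !dim_lker ?pos_covec_neq0.
move=> /subvPn[w]; rewrite !memv_ker => /eqP wi.
case: (ltgtP (p j w : R) 0) => [wj _|wj _|//].
- by exists w.
- by exists (- w); rewrite linearN/= ?wi ?oppr0 ?oppr_lt0.
Qed.

(* A member [b] of a minimal determining set is a wall: points [x0] and [y] on
   the two sides of it, both inside the other members, give a point [z] on it;
   if [z] also lay on another hyperplane, moving it inside the first one would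
   leave the closed cone. *)
Lemma minimal_determines_wall B : determines B ->
  (forall b, b \in B -> ~ determines (B :\ b)) ->
  forall b, b \in B -> is_wall b.
Proof.
move=> BP Bmin b bB; have /existsNP[y /not_implyP[yB ny]] := Bmin b bB.
have yb : (p b y : R) <= 0.
  rewrite leNgt; apply/negP => yb; apply: ny; apply: BP => i iB.
  have [->//|ib] := eqVneq i b.
  by apply: yB; rewrite !inE ib.
pose z := (p b x0 : R) *: y - (p b y : R) *: x0.
have pz i : p i z = (p b x0 : R) * p i y - (p b y : R) * p i x0 :> R.
  by rewrite linearB !linearZ.
have zb : p b z = 0 by apply: etrans (pz b) _; rewrite mulrC subrr.
have zB i : i \in B -> i != b -> 0 < (p i z : R).
  move=> iB ib; rewrite pz -mulNr ltr_pwDl//.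
    by rewrite mulr_gt0// yB// !inE ib.
  by rewrite mulr_ge0 ?oppr_ge0// ltW.
exists z => // i ib.
have zi : 0 <= (p i z : R).
  apply: (determines_closed BP) => j jB.
  by have [->|jb] := eqVneq j b; [rewrite zb|rewrite ltW ?zB].
rewrite lt_neqAle zi andbT eq_sym; apply/eqP => zi0.
have [w wb wi] : exists2 w, p b w = 0 & (p i w : R) < 0.
  by apply: separate_lker; rewrite eq_sym.
have [e e0 he] := sv_perturb p z w.
have : 0 <= (p i (z + e *: w) : R).
  apply: (determines_closed BP) => j jB.
  have [->|jb] := eqVneq j b.
    by rewrite linearD linearZ/= zb wb scaler0 addr0.
  have zj := zB j jB jb; apply: ltW.
  by rewrite -sg3_eq1 he ?sg3_eq1// gt_eqF.
rewrite linearD linearZ/= zi0 add0r leNgt => /negP; apply.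
by rewrite /GRing.scale/= pmulr_rlt0.
Qed.

(** An inclusion-minimal determining set consists of walls, hence lies in [B]. *)
Lemma walls_determine B : (forall b, is_wall b -> b \in B) -> determines B.
Proof.
move=> WB; pose P := [pred D : {set 'I_n} | `[< determines D >]].
have [|D /minsetP[/asboolP DP Dmin] _] := @minset_exists _ P [set: 'I_n]%SET _.
  by apply/asboolP => x h i; apply: h; rewrite inE.
have DW b : b \in D -> is_wall b.
  apply: minimal_determines_wall => // {}b bD db.
  have := Dmin (D :\ b)%SET (asboolT db) (subD1set _ _).
  by move/setP/(_ b); rewrite !inE eqxx bD.
by move=> x xB; apply: DP => b /DW/WB/xB.
Qed.

End OpenCones.

(** For [s] without zeros, the chamber of [s] becomes the open cone on which all these covectors are
    positive. *)
Definition orient (R : realType) n (c : 'I_n -> covec R) (s : signs n)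
  (i : 'I_n) : covec R := (if s i == 1 then 1 else -1) *: c i.

(** [k] is the linear dimension of the cone, one more than the dimension of its projective cell. *)
Definition cell_signs (R : realType) n (c : 'I_n -> covec R) (k : nat) :
  {set signs n} := [set s | realizable c s & \dim (zflat c s) == k]%SET.

(** * Lower bound on the number of walls, and dual bases *)

Section Counting.
Variables (R : realType) (n : nat) (c : 'I_n -> covec R).
Hypothesis c_neq0 : forall i, c i != 0.
Hypothesis c_inj : forall i j, lker (c i) = lker (c j) -> i = j.
Hypothesis c_ess : forall x, (forall i, c i x = 0) -> x = 0.
Implicit Types (s t : signs n) (x y w : vec R).

Lemma orientE s i x :
  orient c s i x = (if s i == 1 then c i x else - c i x) :> R.
Proof.
by rewrite /orient scale_lfunE; case: ifP; rewrite ?scale1r ?scaleN1r.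
Qed.

Lemma orient_eq0 s i x : (orient c s i x == 0) = (c i x == 0).
Proof. by rewrite orientE; case: ifP; rewrite ?oppr_eq0. Qed.

Lemma orient_gt0 s i x : s i != 0 ->
  (0 < (orient c s i x : R)) = (sg3 (c i x) == s i).
Proof.
rewrite orientE => /Z3_neq0[]->; first by rewrite eqxx sg3_eq1.
by rewrite sg3_eqN1 oppr_gt0.
Qed.

Lemma orient_ge0 s i x : s i != 0 ->
  (0 <= (orient c s i x : R)) = (sg3 (c i x) == 0) || (sg3 (c i x) == s i).
Proof.
by move=> si; rewrite le_eqVlt orient_gt0// eq_sym orient_eq0 sg3_eq0.
Qed.

Lemma lker_orient s i : lker (orient c s i) = lker (c i).
Proof.
apply/vspaceP => x; rewrite !memv_ker /orient scale_lfunE scaler_eq0.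
by case: ifP; rewrite ?oppr_eq0 oner_eq0.
Qed.

Lemma is_wall_orient s b : (forall i, s i != 0) ->
  is_wall (orient c s) b <-> b \in walls c s.
Proof.
move=> s0; rewrite inE; split=> [[z zb zi]|/realizableP[z zs]].
  apply/realizableP; exists z; apply: sv_eq => i; rewrite ffunE.
  have [->|ib] := eqVneq i b.
    by apply/eqP; rewrite sg3_eq0 -(orient_eq0 s) zb.
  by apply/eqP; rewrite -orient_gt0// zi.
have {}zs i : sg3 (c i z) = if i == b then 0 else s i.
  by move/ffunP/(_ i): zs; rewrite !ffunE.
exists z.
  by apply/eqP; rewrite orient_eq0 -sg3_eq0 zs eqxx.
by move=> i ib; rewrite orient_gt0// zs (negPf ib).
Qed.

Section Chamber.
Variable s : signs n.
Hypothesis s_neq0 : forall i, s i != 0.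
Hypothesis s_real : realizable c s.

Lemma chamber_orient : exists x, forall i, 0 < (orient c s i x : R).
Proof.
by case/realizableP: s_real => x xs; exists x => i; rewrite orient_gt0// -xs
  ffunE.
Qed.

Lemma walls_determine_chamber : determines (orient c s) (walls c s).
Proof.
have [x0 x0P] := chamber_orient.
apply: (walls_determine x0P) => [i j|b]; first by rewrite !lker_orient => /c_inj.
by rewrite is_wall_orient.
Qed.

(** The walls are constant along the line through [x0] with direction [x], so this whole line stays
    in the chamber; a covector nonzero at [x] would vanish somewhere on it, at the parameter [t]. *)
Lemma walls_essential x : (forall b, b \in walls c s -> c b x = 0) -> x = 0.
Proof.
move=> xW; have [x0 x0P] := chamber_orient.
apply: c_ess => i; apply/eqP; rewrite -(orient_eq0 s); apply/negPn/negP => xi.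
pose t : R := - (orient c s i x0 : R) / orient c s i x.
have /walls_determine_chamber/(_ i) :
    forall b, b \in walls c s -> 0 < (orient c s b (x0 + t *: x) : R).
  move=> b /xW/eqP; rewrite -(orient_eq0 s) => /eqP xb.
  by rewrite linearD linearZ/= xb scaler0 addr0.
by rewrite linearD linearZ/= /GRing.scale/= /t divfK ?subrr ?ltxx.
Qed.

End Chamber.

Lemma dim_bigcap_lker (r : seq 'I_n) :
  (4 <= size r + \dim (\bigcap_(i <- r) lker (c i)))%N.
Proof.
elim: r => [|i r IH]; first by rewrite big_nil dimvf.
rewrite big_cons /=; set X := (\bigcap_(j <- r) _)%VS in IH *.
have [h|/dim_cap_lker h] := boolP (X <= lker (c i))%VS.
  by rewrite (capv_idPr h) addSn ltnW.
by move: IH; rewrite h addnS addSn.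
Qed.

Lemma common_zero (D : {set 'I_n}) : (#|D| < 4)%N ->
  exists2 w, w != 0 & forall i, i \in D -> c i w = 0.
Proof.
move=> D4; have := dim_bigcap_lker (enum D); rewrite -cardE.
set X := (\bigcap_(i <- _) _)%VS => X4.
have X0 : X != 0%VS.
  by rewrite -dimv_eq0; apply: contraL X4 => /eqP->; rewrite addn0 -ltnNge.
exists (vpick X); first by rewrite vpick0.
move=> i iD; apply/eqP; rewrite -memv_ker.
apply: (subvP _ _ (memv_pick X)); rewrite /X.
by rewrite (big_rem i) ?mem_enum//= capvSl.
Qed.

(** Fewer than four covectors on a space of dimension 4 have a common nonzero zero, which
    [walls_essential] forbids. *)
Lemma card_walls_ge4 s : (forall i, s i != 0) -> realizable c s ->
  (4 <= #|walls c s|)%N.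
Proof.
move=> s0 sr; rewrite leqNgt; apply/negP => /common_zero[w w0 /walls_essential].
by move=> /(_ s0 sr) /eqP; rewrite (negPf w0).
Qed.

(* When the walls are four in number, their covectors form a basis; [w] is a
   sum of vectors of the dual basis, up to positive factors. *)
Lemma walls_dual_basis s (S : {set 'I_n}) : (forall i, s i != 0) ->
  realizable c s -> #|walls c s| = 4%N -> S \subset walls c s ->
  exists w, forall b, b \in walls c s ->
    sg3 (c b w) = if b \in S then s b else 0.
Proof.
move=> s0 sr W4 SW.
(* The three other walls have a common nonzero zero, at which [c b] cannot vanish by
   [walls_essential]; its opposite is taken when the sign is wrong. *)
have dual b : b \in walls c s -> exists2 w, sg3 (c b w) = s b &
    forall a, a \in walls c s -> a != b -> c a w = 0.
  move=> bW; have [|w w0 wW] := @common_zero (walls c s :\ b).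
    by have := cardsD1 b (walls c s); rewrite W4 bW add1n => -[<-].
  have {}wW a : a \in walls c s -> a != b -> c a w = 0.
    by move=> aW ab; apply: wW; rewrite !inE ab; move: aW; rewrite inE.
  have : c b w != 0.
    apply: contra w0 => /eqP wb; apply/eqP; apply: (walls_essential s0 sr) => a.
    by have [->|ab /wW/(_ ab)] := eqVneq a b.
  rewrite -sg3_eq0 => /Z3_neq0 wb.
  have [wsb|wsb] : sg3 (c b w) = s b \/ sg3 (c b w) = - s b.
    by case: (Z3_neq0 (s0 b)) wb => -> []; rewrite ?opprK; auto.
  - by exists w.
  - exists (- w); first by rewrite linearN sg3N wsb opprK.
    by move=> a aW ab; rewrite linearN/= wW// oppr0.
(* The default 0 off the walls makes the family total, so that [choice] applies. *)
have dual_total b : exists w, b \in walls c s -> sg3 (c b w) = s b /\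
    forall a, a \in walls c s -> a != b -> c a w = 0.
  have [/dual[w w1 w2]|_] := boolP (b \in walls c s); last by exists 0.
  by exists w.
have [f fP] := choice dual_total.
exists (\sum_(a in S) f a) => b bW; rewrite linear_sum/=.
have [bS|bS] := ifPn.
  rewrite (bigD1 b)//= big1 ?addr0 ?(fP b bW).1// => a /andP[aS ab].
  by rewrite (fP a (fintype.subsetP SW _ aS)).2// eq_sym.
apply/eqP; rewrite sg3_eq0; apply/eqP.
apply: big1 => a aS; rewrite (fP a (fintype.subsetP SW _ aS)).2//.
by apply: contraNneq bS => ->.
Qed.

End Counting.

(** * Numbers of sign vectors *)

Section FaceNumbers.
Variables (R : realType) (n : nat) (c : 'I_n -> covec R).
Hypothesis c_neq0 : forall i, c i != 0.
Hypothesis c_inj : forall i j, lker (c i) = lker (c j) -> i = j.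
Hypothesis c_ess : forall x, (forall i, c i x = 0) -> x = 0.
Implicit Types (s t : signs n) (x y w : vec R).

Lemma zflat_sub s i : s i = 0 -> (zflat c s <= lker (c i))%VS.
Proof.
by move=> si; apply/subvP => x /mem_zflat/(_ i); rewrite si eqxx memv_ker =>
  /(_ isT)->.
Qed.

Lemma dim_zflat_eq4 s : (\dim (zflat c s) == 4%N) = [forall i, s i != 0].
Proof.
apply/idP/forallP => [d4 i|s0].
  apply: contra (fullvN_lker (c_neq0 i)) => /eqP/zflat_sub; apply: subv_trans.
  suff -> : zflat c s = fullv by [].
  by apply/eqP; rewrite eqEdim subvf dimvf (eqP d4).
rewrite /zflat big_pred0 ?dimvf// => i; exact/negbTE.
Qed.

(** Covectors vanishing on a common subspace of dimension 3 have the same kernel, and the planes are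
    distinct. *)
Lemma dim_zflat_eq3 s :
  reflect (exists b, forall i, (s i == 0) = (i == b))
    (\dim (zflat c s) == 3%N).
Proof.
apply: (iffP idP) => [d3|[b sb]].
  have /forallPn[b /negPn/eqP sb] : ~~ [forall i, s i != 0].
    by rewrite -dim_zflat_eq4 (eqP d3).
  have zE i : s i = 0 -> zflat c s = lker (c i).
    by move=> si; apply/eqP; rewrite eqEdim zflat_sub//= dim_lker// (eqP d3).
  exists b => i; apply/eqP/eqP => [si|->//].
  by apply: c_inj; rewrite -!zE.
by rewrite /zflat (big_pred1 b)// dim_lker.
Qed.

Lemma dim_zflat_eq0 s : realizable c s -> (\dim (zflat c s) == 0%N) = (s == 0).
Proof.
move=> /realizableP[x xs]; apply/idP/eqP => [|s0].
  rewrite dimv_eq0 => /eqP z0; have := mem_zflat_sv c x.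
  by rewrite xs z0 memv0 => /eqP x0; rewrite -xs x0 sv0.
rewrite dimv_eq0 -subv0; apply/subvP => y /mem_zflat y0.
by rewrite memv0; apply/eqP/c_ess => i; rewrite y0// s0 ffunE.
Qed.

Lemma cell_signs0 : cell_signs c 0 = [set (0 : signs n)]%SET.
Proof.
apply/setP => s; rewrite !inE; apply/andP/eqP => [[sr]|->].
  by rewrite dim_zflat_eq0// => /eqP.
have r0 : realizable c 0 by apply/realizableP; exists 0; rewrite sv0.
by rewrite dim_zflat_eq0// eqxx.
Qed.

(** In [euler] the origin is the only cone of dimension 0; its term cancels the right-hand side
    1. *)
Lemma euler_cells :
  (#|cell_signs c 4| + #|cell_signs c 2| =
   #|cell_signs c 3| + #|cell_signs c 1|)%N.
Proof.
have := euler c.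
have d5 s : (\dim (zflat c s) < 5)%N.
  by rewrite ltnS; have := dimvS (subvf (zflat c s)); rewrite dimvf.
rewrite (partition_big (fun s => Ordinal (d5 s)) xpredT)//=.
rewrite !big_ord_recl big_ord0 /=.
have cE k (k5 : (k < 5)%N) : \sum_(s | realizable c s &&
    (Ordinal (d5 s) == Ordinal k5)) (-1) ^+ \dim (zflat c s) =
    (-1) ^+ k * #|cell_signs c k|%:Z :> int.
  rewrite (eq_bigr (fun=> (-1) ^+ k)) => [|s /andP[_ /eqP[->]]//].
  rewrite sumr_const -mulr_natr natz; congr (_ * Posz _).
  by apply: eq_card => s; rewrite !inE.
rewrite (cE 0%N isT) (cE 1%N isT) (cE 2%N isT) (cE 3%N isT) (cE 4%N isT).
rewrite cell_signs0 cards1 !exprS expr0 !mulN1r !opprK !mul1r addr0.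
move: #|_| #|_| #|_| #|_| => a b d e; lia.
Qed.

Lemma mem_cell_signs4 s :
  (s \in cell_signs c 4) = realizable c s && [forall i, s i != 0].
Proof. by rewrite inE dim_zflat_eq4. Qed.

(** From a point where at most [c b] vanishes, a small move off the hyperplane [b] reaches either
    side without changing the other signs. *)
Lemma realizable_flip s b u : realizable c s -> s b = 0 ->
  (forall i, s i = 0 -> i = b) -> realizable c (flip s b u).
Proof.
move=> /realizableP[x xs] sb s0.
have [->|/Z3_neq0 u0] := eqVneq u 0.
  apply/realizableP; exists x; rewrite xs; apply/ffunP => i; rewrite ffunE.
  by case: eqP => // ->.
have [w _ wb] : exists2 w, w \in fullv & c b w != 0.
  have /subvPn[w wf] := fullvN_lker (c_neq0 b).
  by rewrite memv_ker; exists w.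
have {w wb} [w wb] : exists w, sg3 (c b w) = u.
  move: wb; rewrite -sg3_eq0 => /Z3_neq0 wb.
  have [wu|wu] : sg3 (c b w) = u \/ sg3 (c b w) = - u.
    by case: u0 wb => -> []; rewrite ?opprK; auto.
  - by exists w.
  - by exists (- w); rewrite linearN sg3N wu opprK.
have [e e0 he] := sv_perturb c x w.
have xb : c b x = 0 by apply/eqP; rewrite -sv_eq0 xs sb.
apply/realizableP; exists (x + e *: w); apply: sv_eq => i; rewrite ffunE.
have [->|ib] := eqVneq i b.
  by rewrite linearD linearZ/= xb add0r sg3M_gt0.
rewrite he; first by rewrite -xs ffunE.
by rewrite -sv_eq0 xs; apply/eqP => /s0 /eqP; rewrite (negPf ib).
Qed.

Lemma sum_walls :
  (\sum_(s in cell_signs c 4) #|walls c s| = 2 * #|cell_signs c 3|)%N.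
Proof.
pose P := [set p : signs n * 'I_n | (p.1 \in cell_signs c 4) &&
  (p.2 \in walls c p.1)]%SET.
have -> : (\sum_(s in cell_signs c 4) #|walls c s| = #|P|)%N.
  rewrite -sum1_card.
  under eq_bigr do rewrite -sum1_card.
  by rewrite pair_big_dep; apply: eq_bigl => p; rewrite [RHS]inE.
(* An incidence of a chamber with a wall is encoded by the facet and the side of the wall on which
   the chamber lies; [f] is a bijection from incidences onto facets times [bool]. *)
pose f (p : signs n * 'I_n) := (flip p.1 p.2 0, p.1 p.2 == 1).
have Pneq0 s b : (s, b) \in P -> forall i, s i != 0.
  by rewrite inE mem_cell_signs4 => /andP[/andP[_ /forallP]].
have f_inj : {in P &, injective f}.
  move=> [s b] [s' b'] /Pneq0 s0 /Pneq0 s0' [/ffunP e1 e2].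
  have bb' : b = b'.
    have := e1 b; rewrite !ffunE eqxx; case: eqP => // _ /esym/eqP.
    by rewrite (negPf (s0' b)).
  rewrite bb' in e1 e2 *; congr pair; apply/ffunP => i.
  have := e1 i; rewrite !ffunE; case: eqP => // -> _.
  have := e2; rewrite /= {e1 e2 bb'}.
  by case: (Z3_neq0 (s0 b')) => ->; case: (Z3_neq0 (s0' b')) => ->.
rewrite -(card_in_imset f_inj).
have -> : (f @: P = finset.setX (cell_signs c 3) [set: bool])%SET.
  apply/setP => -[t u]; rewrite finset.in_setX finset.in_setT andbT.
  apply/imsetP/idP => [[[s b] sbP [-> _]]|].
    move: (sbP); rewrite inE => /andP[_]; rewrite inE => r.
    rewrite inE r /=; apply/dim_zflat_eq3; exists b => i; rewrite ffunE.
    by case: (i == b); rewrite ?eqxx ?(negPf (Pneq0 _ _ sbP i)).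
  rewrite inE => /andP[tr /dim_zflat_eq3[b tb]].
  have tb0 : t b = 0 by apply/eqP; rewrite tb.
  have [v v0 vu] : exists2 v : 'Z_3, v != 0 & (v == 1) = u.
    by exists (if u then 1 else -1); case: (u).
  have fl : flip (flip t b v) b 0 = t.
    by apply/ffunP => i; rewrite !ffunE; case: eqP => // ->.
  exists (flip t b v, b).
    rewrite inE mem_cell_signs4 !inE fl tr andbT /=; apply/andP; split.
      by apply: realizable_flip => // i /eqP; rewrite tb => /eqP.
    by apply/forallP => i; rewrite ffunE; case: ifP => // ib; rewrite tb ib.
  by rewrite /f /= fl ffunE eqxx vu.
by rewrite cardsX cardsT card_bool mulnC.
Qed.

(** By [sum_walls], twice the number of facet cones minus four times the number of chamber cones is
    the total excess over four walls, a sum of nonnegative terms. *)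
Lemma card_walls_eq4P :
  #|cell_signs c 3| = (2 * #|cell_signs c 4|)%N <->
  forall s, s \in cell_signs c 4 -> #|walls c s| = 4%N.
Proof.
have W4 s : s \in cell_signs c 4 -> (4 <= #|walls c s|)%N.
  rewrite mem_cell_signs4 => /andP[sr /forallP s0].
  exact: card_walls_ge4.
have := sum_walls.
have -> : (\sum_(s in cell_signs c 4) #|walls c s| =
    \sum_(s in cell_signs c 4) (#|walls c s| - 4) + 4 * #|cell_signs c 4|)%N.
  rewrite mulnC -sum_nat_const -big_split/=; apply: eq_bigr => s sE.
  by rewrite subnK ?W4.
set S := (\sum_(s in _) _)%N => SE; split => [e|h].
  have /eqP : S = 0%N by lia.
  rewrite sum_nat_eq0 => /forall_inP h s sE; apply/eqP.
  by rewrite eqn_leq W4// -subn_eq0 h.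
have S0 : S = 0%N by rewrite /S big1// => s /h->.
lia.
Qed.

End FaceNumbers.

(** * Cells of the projective space *)

Local Open Scope classical_set_scope.

Section ProjectiveSpace.
Variable R : realType.
Implicit Types (u v : nonzero R) (x y : vec R).

Lemma covec_continuous (a : covec R) : continuous (fun x => a x : R).
Proof.
have aE x : a x = \sum_(j < 4) (x 0 j * (a (delta_mx 0 j) : R)) :> R.
  rewrite {1}[x]row_sum_delta linear_sum; apply: eq_bigr => j _.
  by rewrite linearZ.
rewrite (_ : (fun x => a x : R) =
  (fun x => \sum_(j < 4) (x 0 j * (a (delta_mx 0 j) : R)))); last exact/funext.
apply: continuous_big => [|j _ y]; first exact: add_continuous.
apply: (@continuousM _ _ (fun x : vec R => x 0 j) (cst (a (delta_mx 0 j) : R))).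
  exact: coord_continuous.
exact: cst_continuous.
Qed.

Lemma val_continuous : continuous (set_val : nonzero R -> vec R).
Proof. exact: initial_continuous. Qed.

Lemma to_P3_continuous : continuous (@to_P3 R).
Proof. exact: pi_continuous. Qed.

Lemma to_P3_surj (p : P3 R) : exists v, to_P3 v = p.
Proof. by exists (repr p); rewrite /to_P3 reprK. Qed.

Lemma val_neq0 v : set_val v != 0.
Proof. by have := set_valP v; rewrite /nonzero. Qed.

Lemma nonzeroE x : x != 0 -> exists v : nonzero R, set_val v = x.
Proof. by move=> x0; exists (exist _ x (mem_set x0)); rewrite set_valE. Qed.

Lemma to_P3_eq u v :
  to_P3 u = to_P3 v <-> exists2 k : R, k != 0 & set_val u = k *: set_val v.
Proof.
split=> [/eqmodP|[k k0 uv]].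
  rewrite /= /same_line => /eqP uv.
  have /vlineP[k kv] : set_val u \in <[set_val v]>%VS by rewrite -uv memv_line.
  exists k => //; apply: contraNneq (val_neq0 u) => k0.
  by rewrite kv k0 scale0r.
apply/eqmodP; rewrite /= /same_line uv; apply/eqP/vspaceP => x.
apply/vlineP/vlineP => -[l ->]; first by exists (l * k); rewrite scalerA.
by exists (l / k); rewrite scalerA divfK.
Qed.

Lemma open_to_P3 (U : set (P3 R)) :
  open (@to_P3 R @^-1` U) -> open U.
Proof. by []. Qed.

Lemma closed_to_P3 (U : set (P3 R)) :
  closed (@to_P3 R @^-1` U) -> closed U.
Proof. by rewrite -[X in X -> _]openC -[X in _ -> X]openC. Qed.

End ProjectiveSpace.

(** The face order of oriented matroids: for realizable sign vectors, the cone of [s] lies in the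
    closure of the cone of [t]. *)
Definition face_of n (s t : signs n) : bool :=
  [forall i, (s i == 0) || (s i == t i)].

Definition cell (R : realType) n (c : 'I_n -> covec R) (s : signs n) :
  set (P3 R) := [set to_P3 v | v in [set v | sv c (set_val v) = s]].

(** When [Z] collects the planes containing a flat, this is the flat minus all the other planes. *)
Definition stratum (R : realType) n (c : 'I_n -> covec R) (Z : {set 'I_n}) :
  set (P3 R) :=
  [set to_P3 v | v in
    [set v | forall i, (c i (set_val v) == 0) = (i \in Z)]].

Section Cells.
Variables (R : realType) (n : nat) (c : 'I_n -> covec R).
Implicit Types (s t : signs n) (u v : nonzero R) (x y : vec R).

Lemma to_P3_sv u v : to_P3 u = to_P3 v ->
  sv c (set_val u) = sv c (set_val v) \/ sv c (set_val u) = - sv c (set_val v).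
Proof.
move=> /to_P3_eq[k k0 ->]; case: (ltgtP k 0) k0 => // h _.
  by right; rewrite svZ_lt0.
by left; rewrite svZ_gt0.
Qed.

Lemma cellN s : cell c (- s) = cell c s.
Proof.
suff sub t : cell c t `<=` cell c (- t).
  by apply/seteqP; split; [have := sub (- s); rewrite opprK|exact: sub].
move=> _ [v <- <-]; have [w wv] : exists w : nonzero R, set_val w = - set_val v.
  by apply: nonzeroE; rewrite oppr_eq0 val_neq0.
exists w; first by rewrite /= wv svN.
by apply/to_P3_eq; exists (-1); rewrite ?wv ?scaleN1r// oppr_eq0 oner_eq0.
Qed.

Lemma cellP s v :
  cell c s (to_P3 v) <-> sv c (set_val v) = s \/ sv c (set_val v) = - s.
Proof.
split=> [[u <- /to_P3_sv[]->]|[vs|vs]]; rewrite ?opprK; [by auto|by auto| |].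
  by exists v.
by rewrite -cellN; exists v.
Qed.

Lemma cell_eq s t : realizable c s -> s != 0 ->
  cell c s = cell c t -> s = t \/ s = - t.
Proof.
move=> /realizableP[x xs] s0 st.
have [v vx] : exists v : nonzero R, set_val v = x.
  by apply: nonzeroE; apply: contraNneq s0 => x0; rewrite -xs x0 sv0.
have : cell c t (to_P3 v) by rewrite -st; apply/cellP; rewrite vx; left.
by move=> /cellP; rewrite vx xs.
Qed.

Lemma face_of_refl s : face_of s s.
Proof. by apply/forallP => i; rewrite eqxx orbT. Qed.

Lemma face_ofN s t : face_of (- s) (- t) = face_of s t.
Proof.
by apply: eq_forallb => i; rewrite !ffunE oppr_eq0 eqr_opp.
Qed.

Lemma face_of_anti s t : face_of s t -> face_of t s -> s = t.
Proof.
move=> /forallP st /forallP ts; apply/ffunP => i.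
case/orP: (st i) => /eqP // s0; rewrite s0.
by case/orP: (ts i) => /eqP ->; rewrite ?s0.
Qed.

Lemma face_of_trans r s t : face_of r s -> face_of s t -> face_of r t.
Proof.
move=> /forallP rs /forallP st; apply/forallP => i.
case/orP: (rs i) => /eqP-> ; first by rewrite eqxx.
exact: st.
Qed.

Lemma closed_face_of s :
  closed [set v : nonzero R | face_of (sv c (set_val v)) s].
Proof.
have closed_sign (a : covec R) (r : 'Z_3) :
    closed [set v : nonzero R |
      (sg3 (a (set_val v)) == 0) || (sg3 (a (set_val v)) == r)].
  have ac : continuous (fun v : nonzero R => a (set_val v) : R).
    move=> v; apply: (@continuous_comp _ _ _ set_val (fun x => a x : R)).
      exact: val_continuous.
    exact: covec_continuous.
  pose f (v : nonzero R) : R := a (set_val v).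
  case: (Z3_cases r) => ->.
  - rewrite (_ : [set _ | _] = f @^-1` [set 0]).
      by apply: closed_comp => [v _|]; [exact: ac|exact: closed_eq].
    by apply/seteqP; split=> v /=; rewrite orbb sg3_eq0 => /eqP.
  - rewrite (_ : [set _ | _] = f @^-1` [set x | 0 <= x]).
      by apply: closed_comp => [v _|]; [exact: ac|exact: closed_ge].
    by apply/seteqP; split=> v /=; rewrite sg3_eq0 sg3_eq1 le_eqVlt eq_sym.
  - rewrite (_ : [set _ | _] = f @^-1` [set x | x <= 0]).
      by apply: closed_comp => [v _|]; [exact: ac|exact: closed_le].
    by apply/seteqP; split=> v /=; rewrite sg3_eq0 sg3_eqN1 le_eqVlt.
rewrite (_ : [set _ | _] = \bigcap_(i in setT) [set v : nonzero R |
    (sg3 (c i (set_val v)) == 0) || (sg3 (c i (set_val v)) == s i)]).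
  by apply: closed_bigI => i _; exact: closed_sign.
apply/seteqP; split=> [v /forallP h i _|v h].
  by have := h i; rewrite ffunE.
by apply/forallP => i; rewrite ffunE; exact: h.
Qed.

(** Nonzero signs persist nearby by continuity, and the zeros of [s] impose no condition. *)
Lemma open_sign s :
  open [set v : nonzero R | face_of s (sv c (set_val v))].
Proof.
rewrite openE => v /forallP vs; rewrite /interior/=.
have : \forall u \near v, forall i, (s i == 0) || (s i == sv c (set_val u) i).
  apply: (@filter_forall _ _ (fun i (u : nonzero R) =>
    (s i == 0) || (s i == sv c (set_val u) i)) (nbhs v) _) => i.
  case/orP: (vs i) => [s0|].
    by apply: nearW => u; rewrite s0.
  have ac : (fun u : nonzero R => c i (set_val u) : R) @ v -->
      (c i (set_val v) : R).
    apply: (@continuous_comp _ _ _ set_val (fun x => c i x : R)).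
      exact: val_continuous.
    exact: covec_continuous.
  rewrite eq_sym => /eqP svi.
  case: (Z3_cases (s i)) => si; first by apply: nearW => u; rewrite si.
  - have v0 : 0 < (c i (set_val v) : R).
      by rewrite -sg3_eq1 -[sg3 _]/(sg3 _) -si -svi ffunE.
    have /ac near_v : nbhs (c i (set_val v) : R) [set y | 0 < y].
      by apply: open_nbhs_nbhs; split=> //; exact: open_gt.
    apply: (@filterS _ (nbhs v) _ _ _ _ near_v) => u u0; apply/orP; right.
    by rewrite si ffunE eq_sym sg3_eq1.
  - have v0 : (c i (set_val v) : R) < 0.
      by rewrite -sg3_eqN1 -si -svi ffunE.
    have /ac near_v : nbhs (c i (set_val v) : R) [set y | y < 0].
      by apply: open_nbhs_nbhs; split=> //; exact: open_lt.
    apply: (@filterS _ (nbhs v) _ _ _ _ near_v) => u u0; apply/orP; right.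
    by rewrite si ffunE eq_sym sg3_eqN1.
by apply: (@filterS _ (nbhs v)) => u h; apply/forallP => i; exact: h.
Qed.

End Cells.

(** * Connectedness and closures of cells *)

Section CellTopology.
Variables (R : realType) (n : nat) (c : 'I_n -> covec R).
Implicit Types (s t : signs n) (u v : nonzero R) (x y : vec R).

Lemma sv_segment s x y (k : R) : sv c x = s -> sv c y = s -> 0 <= k <= 1 ->
  sv c (x + k *: (y - x)) = s.
Proof.
move=> xs ys /andP[k0 k1].
have -> : x + k *: (y - x) = (1 - k) *: x + k *: y.
  by rewrite scalerBr scalerBl scale1r addrA addrAC.
have [->|kn0] := eqVneq k 0; first by rewrite subr0 scale1r scale0r addr0.
have [->|kn1] := eqVneq k 1; first by rewrite subrr scale1r scale0r add0r.
rewrite sv_addZ ?ys// ?lt_neqAle 1?eq_sym ?kn0// => i.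
by rewrite svZ_gt0 ?xs ?eqxx ?orbT// subr_gt0 lt_neqAle kn1.
Qed.

Lemma connected_sign_cone s : connected [set x | sv c x = s].
Proof.
have [[x xs]|no] := pselect (exists x, sv c x = s); last first.
  rewrite (_ : [set x | _] = set0); first exact: connected0.
  by apply/seteqP; split=> x //= xs; apply: no; exists x.
pose seg y := (fun k : R => x + k *: (y - x)) @` `[0, 1].
rewrite (_ : [set x | _] = \bigcup_(y in [set y | sv c y = s]) seg y).
  apply: bigcup_connected => [|y ys].
    exists x => y ys; exists 0; last by rewrite scale0r addr0.
    by rewrite /= in_itv/= lexx ler01.
  apply: connected_continuous_connected; first exact: segment_connected.
  apply: continuous_subspaceT => k; apply: cvgD; first exact: cvg_cst.
  exact: scalel_continuous.
apply/seteqP; split=> [y ys|_ [y ys [k /= k01 <-]]].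
  exists y => //; exists 1; last by rewrite scale1r addrC subrK.
  by rewrite /= in_itv/= lexx ler01.
by move: k01; rewrite in_itv/=; exact: sv_segment.
Qed.

Lemma connected_cell s : s != 0 -> connected (cell c s).
Proof.
move=> s0; have [[p _]|no] := pselect (cell c s !=set0); last first.
  rewrite (_ : cell c s = set0); first exact: connected0.
  by apply/seteqP; split=> p //= ps; apply: no; exists p.
(* [to_P3] is defined on nonzero vectors only; [f] extends it to R^4 by the default value [p], so
   that the cell is the image of a convex cone avoiding the origin. *)
pose f := 'valL_p (@to_P3 R).
have fE v : f (set_val v) = to_P3 v.
  by have /(congr1 (fun g => g (@to_P3 R) v)) := @sigL_valL _ _ p (nonzero R).
rewrite (_ : cell c s = f @` [set x | sv c x = s]).
  apply: connected_continuous_connected; first exact: connected_sign_cone.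
  apply: (@continuous_subspaceW _ _ _ (nonzero R)) => [x /= xs|].
    by apply: contraNneq s0 => x0; rewrite -xs x0 sv0.
  exact/subspace_valL_continuousP'/to_P3_continuous.
apply/seteqP; split=> [_ [v vs <-]|_ [x /= xs <-]].
  by exists (set_val v).
have [v vx] : exists v : nonzero R, set_val v = x.
  by apply: nonzeroE; apply: contraNneq s0 => x0; rewrite -xs x0 sv0.
by exists v; rewrite /= -?fE vx.
Qed.

Lemma same_zeros_face s t : (forall i, (s i == 0) = (t i == 0)) ->
  face_of s t -> s = t.
Proof.
move=> z /forallP st; apply/ffunP => i; case/orP: (st i) => /eqP// si.
by rewrite si; apply/esym/eqP; rewrite -z si.
Qed.

Lemma face_of_oppr s t : face_of s (- t) = face_of (- s) t.
Proof. by rewrite -face_ofN opprK. Qed.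

(** The cell is connected, and clopen in the component: once the zero set is fixed, the open
    condition of having [s] as a face and the closed one of being a face of [s] both reduce to
    equality with [s]. Each is taken up to sign, to be well defined on P^3. *)
Lemma component_stratum (Z : {set 'I_n}) v :
  (forall i, (c i (set_val v) == 0) = (i \in Z)) -> sv c (set_val v) != 0 ->
  connected_component (stratum c Z) (to_P3 v) = cell c (sv c (set_val v)).
Proof.
set s := sv c (set_val v) => vZ s0; have sZ i : (s i == 0) = (i \in Z).
  by rewrite sv_eq0.
have cellZ : cell c s `<=` stratum c Z.
  by move=> _ [u us <-]; exists u => //= i; rewrite -sv_eq0 us sZ.
apply/seteqP; split; last first.
  by apply: connected_component_max (connected_cell s0) => //; exists v.
pose Q := connected_component (stratum c Z) (to_P3 v).
have QZ u : Q (to_P3 u) -> forall i, (sv c (set_val u) i == 0) = (s i == 0).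
  move=> /connected_component_sub[w wZ /to_P3_sv uw] i.
  rewrite sZ -wZ -sv_eq0; case: (uw _ c) => -> //.
  by rewrite [(- sv c (set_val u)) i]ffunE oppr_eq0.
have vQ : Q (to_P3 v) by apply: connected_component_refl; exists v.
suff QE : Q `&` cell c s = Q by rewrite -/Q -QE => p [].
apply: component_connected.
- by exists (to_P3 v); split=> //; exists v.
- exists [set p | exists2 u, to_P3 u = p &
      face_of s (sv c (set_val u)) \/ face_of (- s) (sv c (set_val u))].
    apply: open_to_P3; rewrite (_ : _ @^-1` _ =
      [set u | face_of s (sv c (set_val u))] `|`
      [set u | face_of (- s) (sv c (set_val u))]).
      by apply: openU; exact: open_sign.
    apply/seteqP; split=> [u /= [w /(to_P3_sv c) wu]|u us]; last by exists u.
    case: wu => -> //.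
    by rewrite !face_of_oppr !opprK => -[]; auto.
  apply/seteqP; split=> p; have [u <-] := to_P3_surj p.
    move=> [Qu /cellP us]; split=> //; exists u => //.
    by case: us => ->; [left|right]; exact: face_of_refl.
  move=> [Qu [w wu h]]; split=> //; rewrite -wu in Qu *; apply/cellP.
  have zw := QZ _ Qu.
  case: h => h; [left|right]; apply/esym/same_zeros_face => // i; rewrite zw//.
  by rewrite [(- s) i]ffunE oppr_eq0.
- exists [set p | exists2 u, to_P3 u = p &
      face_of (sv c (set_val u)) s \/ face_of (sv c (set_val u)) (- s)].
    apply: closed_to_P3; rewrite (_ : _ @^-1` _ =
      [set u | face_of (sv c (set_val u)) s] `|`
      [set u | face_of (sv c (set_val u)) (- s)]).
      by apply: closedU; exact: closed_face_of.
    apply/seteqP; split=> [u /= [w /(to_P3_sv c) wu]|u us]; last by exists u.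
    case: wu => -> //.
    by rewrite -!face_of_oppr !opprK => -[]; auto.
  apply/seteqP; split=> p; have [u <-] := to_P3_surj p.
    move=> [Qu /cellP us]; split=> //; exists u => //.
    by case: us => ->; [left|right]; exact: face_of_refl.
  move=> [Qu [w wu h]]; split=> //; rewrite -wu in Qu *; apply/cellP.
  have zw := QZ _ Qu.
  case: h => h; [left|right]; apply/same_zeros_face => // i; rewrite zw//.
  by rewrite [(- s) i]ffunE oppr_eq0.
Qed.

(** The face condition is closed and holds on the cell. Conversely, adding to [v] small positive
    multiples of a vector [u] of the cone gives points of the cone tending to [v]. *)
Lemma closure_cell s v : s != 0 ->
  closure (cell c s) (to_P3 v) <->
  cell c s !=set0 /\
  (face_of (sv c (set_val v)) s \/ face_of (sv c (set_val v)) (- s)).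
Proof.
move=> s0; split=> [clv|[[_ [u us _]] vs]].
  split.
    have [p [ps _]] : cell c s `&` setT !=set0.
      by apply: clv; exact: filterT.
    by exists p.
  pose Z := [set p | exists2 u, to_P3 u = p &
      face_of (sv c (set_val u)) s \/ face_of (sv c (set_val u)) (- s)].
  have ZE u : Z (to_P3 u) <->
      face_of (sv c (set_val u)) s \/ face_of (sv c (set_val u)) (- s).
    split=> [[w /(to_P3_sv c) wu]|us]; last by exists u.
    case: wu => -> //.
    by rewrite -!face_of_oppr !opprK => -[]; auto.
  suff : closed Z.
    move=> /closure_id Zcl; apply/ZE; rewrite Zcl; apply: closure_subset clv.
    move=> p; have [w <-] := to_P3_surj p.
    move=> /cellP ws; apply/ZE.
    by case: ws => ->; [left|right]; exact: face_of_refl.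
  apply: closed_to_P3; rewrite (_ : _ @^-1` _ =
      [set u | face_of (sv c (set_val u)) s] `|`
      [set u | face_of (sv c (set_val u)) (- s)]).
    by apply: closedU; exact: closed_face_of.
  by apply/seteqP; split=> w /= /ZE.
wlog {vs} vs : s u s0 us / face_of (sv c (set_val v)) s.
  move=> hw; case: vs => vs; first exact: (hw s u).
  have [w wu] : exists w : nonzero R, set_val w = - set_val u.
    by apply: nonzeroE; rewrite oppr_eq0 val_neq0.
  by rewrite -cellN; apply: (hw (- s) w); rewrite ?oppr_eq0//= wu svN us.
move=> B /to_P3_continuous /= nB.
have [_ /= [[W Wo <-] Wv WB]] := nB.
have : (fun k : R => set_val v + k *: set_val u) @ 0 -->
    set_val v + 0 *: set_val u.
  by apply: cvgD; [exact: cvg_cst|exact: scalel_continuous].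
rewrite scale0r addr0 => /(_ W (open_nbhs_nbhs (conj Wo Wv))).
move=> /nbhs_ballP[e e0 eW].
have e2 : 0 < e / 2 by rewrite divr_gt0.
have ws : sv c (set_val v + (e / 2) *: set_val u) = s.
  by rewrite sv_addZ ?us//; exact/forallP.
have [w wE] : exists w : nonzero R,
    set_val w = set_val v + (e / 2) *: set_val u.
  by apply: nonzeroE; apply: contraNneq s0 => w0; rewrite -ws w0 sv0.
exists (to_P3 w); split; first by exists w; rewrite //= wE.
apply: WB; rewrite /= wE; apply: eW; rewrite /ball/= sub0r normrN gtr0_norm//.
by rewrite ltr_pdivrMr// ltr_pMr// ltr1n.
Qed.

End CellTopology.

(** * Correspondence between cells and pairs of opposite sign vectors *)

Section CellCount.
Variables (R : realType) (n : nat) (c : 'I_n -> covec R).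
Hypothesis c_ess : forall x, (forall i, c i x = 0) -> x = 0.
Implicit Types (s t r : signs n) (u v : nonzero R) (x y : vec R).

Lemma sv_eq0_ess x : (sv c x == 0) = (x == 0).
Proof.
apply/eqP/eqP => [/ffunP x0|->]; last exact: sv0.
by apply: c_ess => i; apply/eqP; rewrite -sv_eq0 x0 ffunE.
Qed.

Lemma sv_val_neq0 v : sv c (set_val v) != 0.
Proof. by rewrite sv_eq0_ess val_neq0. Qed.

Lemma realizable_val s : realizable c s -> s != 0 ->
  exists v : nonzero R, sv c (set_val v) = s.
Proof.
move=> /realizableP[x <-]; rewrite sv_eq0_ess => /nonzeroE[v vx].
by exists v; rewrite vx.
Qed.

Lemma components_stratum (Z : {set 'I_n}) : components (stratum c Z) =
  cell c @` [set s | [/\ realizable c s, s != 0 &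
    forall i, (s i == 0) = (i \in Z)]].
Proof.
apply/seteqP; split=> [_ [_ [v vZ <-] <-]|_ [s [sr s0 sZ] <-]].
  exists (sv c (set_val v)); last by rewrite component_stratum// sv_val_neq0.
  by split=> [||i]; rewrite ?realizable_sv ?sv_val_neq0// sv_eq0.
have [v vs] := realizable_val sr s0.
have vZ i : (c i (set_val v) == 0) = (i \in Z) by rewrite -sZ -vs sv_eq0.
exists (to_P3 v); first by exists v.
by rewrite component_stratum ?sv_val_neq0// vs.
Qed.

Lemma realizable_cell_neq0 s : realizable c s -> s != 0 -> cell c s !=set0.
Proof.
by move=> sr s0; have [v vs] := realizable_val sr s0; exists (to_P3 v), v.
Qed.

Lemma cell_sub_closure s t : realizable c s -> s != 0 ->
  realizable c t -> t != 0 ->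
  cell c s `<=` closure (cell c t) <-> face_of s t \/ face_of s (- t).
Proof.
move=> sr s0 tr t0; split=> [sub|st _ [v vs <-]]; last first.
  by rewrite closure_cell// vs; split=> //; exact: realizable_cell_neq0.
have [v vs] := realizable_val sr s0.
have : closure (cell c t) (to_P3 v) by apply: sub; exists v.
by rewrite closure_cell// vs => -[].
Qed.

Lemma closure_cell_sub s t : realizable c s -> s != 0 ->
  realizable c t -> t != 0 ->
  closure (cell c s) `<=` closure (cell c t) <-> face_of s t \/ face_of s (- t).
Proof.
move=> sr s0 tr t0; rewrite -cell_sub_closure//; split=> [|sub].
  by apply: subset_trans; exact: subset_closure.
rewrite [X in _ `<=` X](closure_id _).1; first exact: closure_subset.
exact: closed_closure.
Qed.

(* [E] splits into the pairs [{s, -s}], each giving one cell of P^3. *)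
Lemma card_cells (E : {set signs n}) :
  (forall s, s \in E -> realizable c s) -> 0 \notin E ->
  (forall s, s \in E -> - s \in E) ->
  #|E| = (2 * #|` fset_set (cell c @` [set` E])|)%N.
Proof.
move=> Er E0 EN.
(* [E'] keeps the member of smaller rank in each pair; the ranks differ since only 0 is its own
   opposite. *)
pose E' := [set s in E | (enum_rank s < enum_rank (- s)%R)%N]%SET.
have EE' s : s \in E -> s \in E' \/ - s \in E'.
  move=> sE; rewrite !inE sE EN// opprK /=.
  case: (ltngtP (enum_rank s) (enum_rank (- s)%R)); [by left|by right|].
  move=> /val_inj/enum_rank_inj /ffunP sN.
  suff s0 : s = 0 by rewrite -s0 sE in E0.
  by apply/ffunP => i; have := sN i; rewrite !ffunE => /eqP; rewrite Z3_eq_opp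
    => /eqP.
have E'N s : s \in E' -> - s \in E' -> False.
  by rewrite !inE opprK => /andP[_ h] /andP[_]; rewrite ltnNge ltnW.
pose opp (s : signs n) : signs n := - s.
have opp_inj : injective opp by exact: oppr_inj.
have -> : #|E| = (2 * #|E'|)%N.
  have -> : E = (E' :|: opp @: E')%SET.
    apply/setP => s; rewrite finset.in_setU; apply/idP/orP.
      move=> /EE'[]; first by left.
      by move=> h; right; apply/imsetP; exists (- s); rewrite /opp ?opprK.
    case=> [|/imsetP[t + ->]]; first by rewrite inE => /andP[].
    by rewrite inE => /andP[/EN].
  rewrite cardsU card_imset//.
  rewrite (_ : _ :&: _ = finset.set0)%SET ?cards0 ?subn0 ?mul2n ?addnn//.
  apply/setP => s; rewrite !finset.in_setI finset.in_set0; apply/negbTE/negP.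
  move=> /andP[sE /imsetP[t tE st]]; apply: (E'N t) => //.
  by move: sE; rewrite st.
congr (2 * _)%N.
have -> : fset_set (cell c @` [set` E]) = [fset cell c s | s in E']%fset.
  apply/fsetP => C; rewrite in_fset_set; last first.
    exact: finite_image (finite_finpred _).
  apply/idP/imfsetP => /=.
    rewrite inE => -[s /= sE <-]; have [sE'|sE'] := EE' s sE; first by exists s.
    by exists (- s); rewrite // cellN.
  by move=> [s sE' ->]; rewrite inE; exists s => //=; move: sE'; rewrite inE =>
    /andP[].
rewrite card_in_imfset /=; first by rewrite cardE.
move=> s t sE' tE' st; have [sE tE] : s \in E /\ t \in E.
  by move: sE' tE'; rewrite !inE => /andP[-> _] /andP[-> _].
have [|//|sN] := cell_eq (Er s sE) _ st.
  by apply: contraNneq E0 => <-.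
by case: (E'N t) => //; rewrite -sN.
Qed.

End CellCount.

(** * Cells, chambers and f-vector of an arrangement in terms of sign vectors *)

Section Arrangement.
Variables (R : realType) (A : seq (covec R)).
Hypotheses (A_arr : is_arrangement A) (A_ess : essential A).

Definition hyperplane (i : 'I_(size A)) : covec R := tnth (in_tuple A) i.
Notation c := hyperplane.

Lemma hyperplane_mem i : c i \in A.
Proof. by rewrite /c mem_tnth. Qed.

Lemma hyperplaneP a : a \in A -> exists i, a = c i.
Proof. by move=> aA; have /tnthP[i ai] : a \in in_tuple A by []; exists i. Qed.

Lemma hyperplane_neq0 i : c i != 0.
Proof. by apply: contraNneq A_arr.1 => <-; exact: hyperplane_mem. Qed.

Lemma hyperplane_inj i j : lker (c i) = lker (c j) -> i = j.
Proof.
rewrite /c !(tnth_nth 0) /= => eij; apply/val_inj/eqP.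
have /uniqP := A_arr.2 => /(_ 0%VS) u.
apply/eqP/u; rewrite ?inE ?size_map ?ltn_ord//.
by rewrite !(nth_map 0) ?ltn_ord.
Qed.

(** The covectors span the dual space, so every covector kills [x], in particular the coordinate
    functions. *)
Lemma hyperplane_ess x : (forall i, c i x = 0) -> x = 0.
Proof.
move=> cx; have killed (a : covec R) : a x = 0.
  have : a \in <<A>>%VS by rewrite A_ess memvf.
  move/(coord_span (X := in_tuple A)) => ->; rewrite sum_lfunE big1// => i _.
  by rewrite scale_lfunE -[_`_i](tnth_nth 0 (in_tuple A)) cx scaler0.
apply/rowP => j; rewrite mxE.
pose f (y : vec R) : R^o := y 0 j.
have f_lin : linear f by move=> k y z; rewrite /f !mxE.
pose F := GRing.isLinear.Build _ _ _ _ f f_lin.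
pose fL : {linear vec R -> R^o} := HB.pack f F.
by have := killed (linfun fL); rewrite lfunE.
Qed.

Lemma projectiveP (X : {vspace vec R}) v :
  projective X (to_P3 v) <-> set_val v \in X.
Proof.
split=> [[u uX /esym/to_P3_eq[k _ ->]]|]; last by exists v.
exact: memvZ.
Qed.

Lemma mem_bigcap_lker (B : seq (covec R)) x :
  (x \in \bigcap_(b <- B) lker b)%VS = all (fun b : covec R => b x == 0) B.
Proof.
elim: B => [|b B IH]; first by rewrite big_nil memvf.
by rewrite big_cons memv_cap memv_ker IH.
Qed.

Lemma bigcap_sub_lker (B : seq (covec R)) b : b \in B ->
  (\bigcap_(b <- B) lker b <= lker b)%VS.
Proof.
move=> bB; apply/subvP => y; rewrite mem_bigcap_lker memv_ker.
by move=> /allP/(_ _ bB).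
Qed.

Lemma flat_stratum (B : seq (covec R)) (X := (\bigcap_(b <- B) lker b)%VS) :
  {subset B <= A} ->
  projective X `\` \bigcup_(a in [set a | a \in A /\ ~~ (X <= lker a)%VS])
    projective (lker a) =
  stratum c [set i | (X <= lker (c i))%VS]%SET.
Proof.
move=> BA; apply/seteqP; split=> p; have [v <-] := to_P3_surj p.
  move=> [/projectiveP vX vN]; exists v => // i; rewrite inE; apply/idP/idP.
    move=> /eqP vi; apply/negPn/negP => Xi; apply: vN; exists (c i).
      by split=> //; exact: hyperplane_mem.
    by apply/projectiveP; rewrite memv_ker vi.
  by move=> /subvP/(_ _ vX); rewrite memv_ker.
move=> [w wZ <-]; split.
  apply/projectiveP; rewrite mem_bigcap_lker; apply/allP => b bB.
  have [i bi] := hyperplaneP (BA _ bB).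
  by rewrite bi wZ inE -bi; exact: bigcap_sub_lker.
move=> [a [aA Xa]] /projectiveP; have [i ai] := hyperplaneP aA.
by rewrite ai memv_ker wZ inE -ai (negPf Xa).
Qed.

Lemma zflat_stratum (B : seq (covec R)) (X := (\bigcap_(b <- B) lker b)%VS)
    (s : signs (size A)) :
  {subset B <= A} -> (forall i, (s i == 0) = (X <= lker (c i))%VS) ->
  zflat c s = X.
Proof.
move=> BA sX; apply/vspaceP => y; apply/mem_zflat/idP => [ys|yX i].
  rewrite mem_bigcap_lker; apply/allP => b bB.
  have [i bi] := hyperplaneP (BA _ bB).
  by rewrite bi ys// sX -bi bigcap_sub_lker.
by rewrite sX => /subvP/(_ _ yX); rewrite memv_ker => /eqP.
Qed.

(** A flat minus the other planes is a stratum, whose components are cells by [components_stratum];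
    conversely a sign vector comes from the flat cut out by the covectors at which it is zero. *)
Lemma cellsE k : cells A k = cell c @` [set` cell_signs c k.+1].
Proof.
apply/seteqP; split=> [C [X [dX [B BA XE]]]|_ [s sE <-]].
  rewrite XE flat_stratum// components_stratum; last exact: hyperplane_ess.
  move=> [s [sr s0 sX] <-]; exists s => //=.
  have -> : s \in cell_signs c k.+1 = (\dim (zflat c s) == k.+1).
    by rewrite inE sr.
  rewrite (@zflat_stratum B s BA) => [|i]; last by rewrite sX inE.
  by rewrite -XE dX.
move: sE; rewrite /= inE => /andP[sr /eqP ds].
pose B := [seq c i | i <- index_enum 'I_(size A) & s i == 0].
have zB : zflat c s = (\bigcap_(b <- B) lker b)%VS.
  by rewrite /zflat big_map big_filter.
have BA : {subset B <= A}.
  by move=> _ /mapP[i _ ->]; exact: hyperplane_mem.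
exists (zflat c s); first by split=> //; exists B.
rewrite zB flat_stratum// components_stratum; last exact: hyperplane_ess.
exists s => //; split=> // [|i].
  by rewrite -(dim_zflat_eq0 hyperplane_ess sr) ds.
rewrite inE -zB; apply/eqP/idP => [/zflat_sub->//|].
(* A covector vanishing on the whole flat vanishes at a point realizing [s], hence is zero in
   [s]. *)
case/realizableP: sr => x xs /subvP/(_ x); rewrite -xs mem_zflat_sv => /(_ isT).
by rewrite memv_ker -(sv_eq0 c) => /eqP.
Qed.

Lemma chambersE : chambers A = cell c @` [set` cell_signs c 4].
Proof.
have complE : ~` (\bigcup_(a in [set a | a \in A]) projective (lker a)) =
    projective fullv `\` \bigcup_(a in [set a | a \in A /\
      ~~ (fullv <= lker a)%VS]) projective (lker a).
  have -> : projective fullv = [set: P3 R].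
    by apply/seteqP; split=> p // _; have [v <-] := to_P3_surj p;
      apply/projectiveP; rewrite memvf.
  rewrite setTD; congr (~` _); apply: eq_bigcupl; split=> a /=; last by case.
  move=> aA; split=> //; have [i ->] := hyperplaneP aA.
  exact/fullvN_lker/hyperplane_neq0.
rewrite -cellsE /chambers complE; apply/seteqP; split=> [C CA|C [X [dX _]]].
  exists fullv => //; split; first by rewrite dimvf.
  by exists [::]; rewrite ?big_nil.
suff -> : X = fullv by [].
by apply/eqP; rewrite eqEdim subvf dimvf dX.
Qed.

Lemma f_vectorE k : (2 * f_vector A k)%N = #|cell_signs c k.+1|.
Proof.
rewrite /f_vector cellsE -card_cells//.
- by move=> s; rewrite inE => /andP[].
- rewrite inE; apply/negP => /andP[r0].
  have /eqP -> : \dim (zflat c 0) == 0%N.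
    by rewrite (dim_zflat_eq0 hyperplane_ess).
  by [].
move=> s; rewrite !inE realizableN => /andP[-> /eqP<-] /=; apply/eqP.
by congr (\dim _); apply: eq_bigl => i; rewrite ffunE oppr_eq0.
Qed.

End Arrangement.

(** * Tetrahedral chambers *)

(** Rules out the opposite sign in [closure_cell_sub] when one sign is already known. *)
Lemma face_of_both n (s t : signs n) :
  face_of t s -> face_of t (- s) -> t = 0.
Proof.
move=> /forallP ts /forallP tNs; apply/ffunP => i; rewrite [RHS]ffunE.
apply/eqP; case/orP: (ts i) => // /eqP tsi; case/orP: (tNs i) => // /eqP.
by rewrite ffunE -tsi => /eqP; rewrite Z3_eq_opp.
Qed.

Lemma flip_face_of n (s : signs n) b : face_of (flip s b 0) s.
Proof.
by apply/forallP => i; rewrite ffunE; case: (i == b); rewrite eqxx ?orbT.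
Qed.

(** Maximality of a facet among proper faces: between the two sign vectors only the entry [b] is
    free. *)
Lemma face_of_flip n (s r : signs n) b :
  face_of (flip s b 0) r -> face_of r s -> r = flip s b 0 \/ r = s.
Proof.
move=> /forallP fr /forallP rs.
have rE i : i != b -> r i = s i.
  move=> ib; case/orP: (fr i); rewrite ffunE (negPf ib) => /eqP//.
  by move=> si0; case/orP: (rs i) => /eqP->.
case/orP: (rs b) => /eqP rb; [left|right]; apply/ffunP => i; rewrite ?ffunE;
  by case: (eqVneq i b) => [->//|/rE].
Qed.

Section Tetrahedra.
Variables (R : realType) (A : seq (covec R)).
Hypotheses (A_arr : is_arrangement A) (A_ess : essential A).
Notation c := (@hyperplane R A).
Implicit Types s t r : signs (size A).

Let c_neq0 : forall i, c i != 0 := hyperplane_neq0 A_arr.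
Let c_inj : forall i j, lker (c i) = lker (c j) -> i = j := hyperplane_inj A_arr.
Let c_ess : forall x, (forall i, c i x = 0) -> x = 0 := hyperplane_ess A_ess.

Lemma cells_cell t : realizable c t -> t != 0 -> exists k, cells A k (cell c t).
Proof.
move=> tr t0; exists (\dim (zflat c t)).-1; rewrite cellsE//.
exists t => //=; rewrite inE tr prednK ?eqxx// lt0n dim_zflat_eq0//.
Qed.

Lemma cells_neq0 k s : s \in cell_signs c k.+1 -> realizable c s /\ s != 0.
Proof.
rewrite inE => /andP[sr /eqP sk]; split=> //.
by rewrite -(dim_zflat_eq0 c_ess sr) sk.
Qed.

Lemma facesP s F : realizable c s -> s != 0 ->
  faces A (cell c s) F <->
  exists t, [/\ realizable c t, t != 0, face_of t s & F = cell c t].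
Proof.
move=> sr s0; split=> [[[k Fk] Fs]|[t [tr t0 ts ->]]]; last first.
  split; first exact: cells_cell.
  by apply/cell_sub_closure => //; left.
move: Fk Fs; rewrite cellsE// => -[t /= /cells_neq0[tr t0] <-].
rewrite cell_sub_closure// => -[ts|ts]; first by exists t.
exists (- t); split; rewrite ?realizableN ?oppr_eq0 ?cellN//.
by rewrite -face_of_oppr.
Qed.

Lemma cell_signs4_neq0 s : s \in cell_signs c 4 ->
  realizable c s /\ forall i, s i != 0.
Proof. by rewrite mem_cell_signs4// => /andP[sr /forallP]. Qed.

Lemma flip_wall_signs s b : s \in cell_signs c 4 -> b \in walls c s ->
  flip s b 0 \in cell_signs c 3.
Proof.
move=> /cell_signs4_neq0[_ s0]; rewrite inE => bW; rewrite inE bW /=.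
apply/dim_zflat_eq3 => //; exists b => i; rewrite ffunE.
by case: (i == b); rewrite ?eqxx// (negPf (s0 i)).
Qed.

(* Under an isomorphism of the face poset with the nonempty subsets of 'I_4,
   the facet on a wall, being a maximal proper face, goes to a coatom. *)
Lemma tetrahedron_card_walls s : s \in cell_signs c 4 ->
  combinatorial_tetrahedron A (cell c s) -> #|walls c s| = 4%N.
Proof.
move=> sE [phi [phi_fun phi_inj phi_surj] phi_le].
have [sr sn0] := cell_signs4_neq0 sE; have [_ s0] := cells_neq0 sE.
have Cface : faces A (cell c s) (cell c s).
  by apply/facesP => //; exists s; split=> //; exact: face_of_refl.
have phiC : phi (cell c s) = [set: 'I_4]%SET.
  have [|F FC phiF] := phi_surj [set: 'I_4]%SET.
    by apply/eqP => /setP/(_ ord0); rewrite !inE.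
  apply/eqP; rewrite -finset.subTset -phiF; apply/(phi_le F _ FC Cface).
  have [t [tr t0 ts ->]] := (facesP F sr s0).1 FC.
  by apply/closure_cell_sub => //; left.
pose g b := phi (cell c (flip s b 0)).
have Fface b : b \in walls c s -> faces A (cell c s) (cell c (flip s b 0)).
  move=> bW; have [tr t0] := cells_neq0 (flip_wall_signs sE bW).
  by apply/facesP => //; exists (flip s b 0); split=> //; exact: flip_face_of.
have g_coatom b : b \in walls c s -> exists j, g b = [set~ j]%SET.
  move=> bW; have [tr t0] := cells_neq0 (flip_wall_signs sE bW).
  have gT : g b != [set: 'I_4]%SET.
    apply/eqP; rewrite -phiC => /phi_inj.
    move=> /(_ (mem_set (Fface b bW)) (mem_set Cface)) /(cell_eq tr t0) fs.
    have : flip s b 0 b == 0 by rewrite ffunE eqxx.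
    by case: fs => ->; rewrite ?ffunE ?oppr_eq0 (negPf (sn0 b)).
  have [j jg] : exists j, j \notin g b.
    apply/existsP; rewrite -negb_forall; apply: contra gT => /forallP gT.
    by apply/eqP/setP => j; rewrite gT inE.
  (* The face [G] sent to a coatom above [g b] lies between the facet and the chamber; it is not the
     chamber, so it is the facet. *)
  exists j; have [|G GC phiG] := phi_surj [set~ j]%SET.
    by rewrite /= -card_gt0 cardsC1 card_ord.
  rewrite -phiG /g; congr (phi _).
  have : closure (cell c (flip s b 0)) `<=` closure G.
    apply/(phi_le _ _ (Fface b bW) GC); rewrite phiG.
    by apply/fintype.subsetP => i ig; rewrite !inE; apply: contraNneq jg => <-.
  have [r [rr r0 rs GE]] := (facesP G sr s0).1 GC.
  rewrite GE closure_cell_sub// => -[fr|fr].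
    have [->//|rsE] := face_of_flip fr rs.
    move: phiG; rewrite GE rsE phiC => /setP/(_ j).
    by rewrite !inE eqxx.
  suff t00 : flip s b 0 = 0 by rewrite t00 eqxx in t0.
  apply: (face_of_both (flip_face_of s b)); apply: face_of_trans fr _.
  by rewrite face_ofN.
apply/eqP; rewrite eqn_leq card_walls_ge4// andbT.
have g_inj : {in walls c s &, injective g}.
  move=> b b' bW b'W /phi_inj.
  move=> /(_ (mem_set (Fface b bW)) (mem_set (Fface b' b'W))).
  have [tr t0] := cells_neq0 (flip_wall_signs sE bW).
  move=> /(cell_eq tr t0) fs.
  have : flip s b 0 b == 0 by rewrite ffunE eqxx.
  case: fs => ->; rewrite ?ffunE ?oppr_eq0; case: (eqVneq b b') => // _;
    by rewrite (negPf (sn0 b)).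
rewrite -(card_in_imset g_inj).
apply: (@leq_trans #|[set [set~ j] | j : 'I_4]%SET|).
  apply/subset_leq_card/fintype.subsetP => _ /imsetP[b bW ->].
  by have [j ->] := g_coatom b bW; apply/imsetP; exists j.
by apply: leq_trans (leq_imset_card _ _) _; rewrite card_ord.
Qed.

(* If [t] vanished at [i] where [r] does not, the closed cone would contain
   [y - e x], which is on the wrong side of [i]. *)
Lemma walls_support s t r : s \in cell_signs c 4 ->
  realizable c t -> realizable c r -> face_of t s -> face_of r s ->
  (forall b, b \in walls c s -> r b == 0 -> t b == 0) -> face_of t r.
Proof.
move=> sE /realizableP[x xt] /realizableP[y yr] /forallP ts /forallP rs rt.
have [sr s0] := cell_signs4_neq0 sE; have [x0 x0P] := chamber_orient s0 sr.
have detW := walls_determine_chamber c_inj s0 sr.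
have pos z q : sv c z = q -> (forall i, (q i == 0) || (q i == s i)) ->
    forall i, 0 <= (orient c s i z : R).
  by move=> zq qs i; rewrite orient_ge0//; have := qs i; rewrite -zq ffunE.
have xpos := pos x t xt ts; have ypos := pos y r yr rs.
have orient0 z q i : sv c z = q -> (orient c s i z == 0) = (q i == 0).
  by move=> <-; rewrite orient_eq0 sv_eq0.
apply/forallP => i; have [ri|ri] := eqVneq (r i) 0; last first.
  case/orP: (ts i) => [->//|/eqP->].
  case/orP: (rs i) => /eqP rsi; first by rewrite rsi eqxx in ri.
  by rewrite rsi eqxx orbT.
rewrite ri orbb; apply/negPn/negP => ti.
have [e e0 he] := sv_perturb (orient c s) y (- x).
have : 0 <= (orient c s i (y + e *: (- x)) : R).
  apply: (determines_closed x0P detW) => b bW.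
  have [rb|rb] := boolP (r b == 0).
    have /eqP yb : orient c s b y == 0 by rewrite (orient0 y r).
    have /eqP xb : orient c s b x == 0 by rewrite (orient0 x t)// rt.
    by rewrite linearD linearZ linearN/= xb yb oppr0 scaler0 addr0.
  have yb : orient c s b y != 0 by rewrite (orient0 y r).
  apply: ltW; rewrite -sg3_eq1 he// sg3_eq1 lt_neqAle eq_sym yb.
  exact: ypos.
have /eqP yi : orient c s i y == 0 by rewrite (orient0 y r)// ri.
rewrite linearD linearZ linearN/= yi add0r scalerN oppr_ge0 leNgt => /negP.
by apply; rewrite /GRing.scale/= mulr_gt0// lt_neqAle eq_sym (orient0 x t)// ti
  xpos.
Qed.

(** Order reflection and injectivity come from [walls_support], surjectivity from
    [walls_dual_basis]. *)
Lemma card_walls_tetrahedron s : s \in cell_signs c 4 ->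
  #|walls c s| = 4%N -> combinatorial_tetrahedron A (cell c s).
Proof.
move=> sE W4; have [sr sn0] := cell_signs4_neq0 sE.
have [_ s0] := cells_neq0 sE; have [x0 x0P] := chamber_orient sn0 sr.
have detW := walls_determine_chamber c_inj sn0 sr.
pose e (j : 'I_4) := enum_val (cast_ord (esym W4) j) : 'I_(size A).
have e_inj : injective e by move=> i j /enum_val_inj/cast_ord_inj.
have eW j : e j \in walls c s by exact: enum_valP.
have e_surj b : b \in walls c s -> exists j, b = e j.
  move=> bW; exists (cast_ord W4 (enum_rank_in bW b)).
  by rewrite /e cast_ordK enum_rankK_in.
(* A face is sent to the walls not containing it, that is to its vertices, each vertex being
   labelled by the opposite wall. *)
pose phi (F : set (P3 R)) : {set 'I_4} :=
  [set j | `[< exists2 v, F (to_P3 v) & c (e j) (set_val v) != 0 >]]%SET.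
have phiE t j : realizable c t -> t != 0 ->
    (j \in phi (cell c t)) = (t (e j) != 0).
  move=> tr t0; rewrite inE; apply/asboolP/idP => [[v /cellP vt]|tj].
    rewrite -sv_eq0; case: vt => -> //.
    by rewrite [(- t) _]ffunE oppr_eq0.
  have [v vt] := realizable_val c_ess tr t0.
  by exists v; [exists v|rewrite -sv_eq0 vt].
have support t r : realizable c t -> t != 0 -> face_of t s ->
    realizable c r -> r != 0 -> face_of r s ->
    phi (cell c t) \subset phi (cell c r) -> face_of t r.
  move=> tr t0 ts rr r0 rs /fintype.subsetP sub.
  apply: (walls_support sE) => // b /e_surj[j ->].
  by apply: contraTT => tj; have := sub j; rewrite !phiE//; exact.
exists phi; last first.
  move=> F G /(facesP F sr s0)[t [tr t0 ts ->]].
  move=> /(facesP G sr s0)[r [rr r0 rs ->]].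
  rewrite closure_cell_sub//; split=> [[tr'|tr']|]; last by left; exact: support.
    apply/fintype.subsetP => j; rewrite !phiE//; apply: contra => rj.
    by have /forallP/(_ (e j)) := tr'; rewrite (eqP rj) orbb.
  suff t00 : t = 0 by rewrite t00 eqxx in t0.
  by apply: (face_of_both ts); apply: face_of_trans tr' _; rewrite face_ofN.
split.
- move=> F /(facesP F sr s0)[t [tr t0 ts ->]] /=.
  apply: contra (t0) => /eqP/setP phi0.
  have [v vt] := realizable_val c_ess tr t0.
  suff v0 : set_val v = 0 by rewrite -vt v0 sv0.
  apply: (walls_essential c_inj c_ess sn0 sr) => b /e_surj[j ->].
  apply/eqP; rewrite -sv_eq0 vt.
  by have := phi0 j; rewrite phiE// finset.in_set0 => /negbT/negPn.
- move=> F G /set_mem/(facesP F sr s0)[t [tr t0 ts ->]].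
  move=> /set_mem/(facesP G sr s0)[r [rr r0 rs ->]] tr_eq.
  by congr cell; apply: face_of_anti; apply: support => //; rewrite tr_eq.
move=> S /= S0.
(* [w] has the signs of [s] on the walls of [S] and vanishes on the others, so it lies in the closed
   chamber and its cell is the face sent to [S]. *)
have [|w wS] := @walls_dual_basis _ _ c c_inj c_ess s (e @: S)%SET sn0 sr W4.
  by apply/fintype.subsetP => _ /imsetP[j _ ->].
have wE j : sv c w (e j) = if j \in S then s (e j) else 0.
  by rewrite ffunE wS// mem_imset.
have ws : face_of (sv c w) s.
  apply/forallP => i; rewrite ffunE -orient_ge0//.
  apply: (determines_closed x0P detW) => b /e_surj[j ->].
  rewrite orient_ge0//; have := wE j; rewrite ffunE => ->.
  by case: ifP; rewrite eqxx ?orbT.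
have w0 : sv c w != 0.
  apply: contraNneq S0 => w0; apply/eqP/setP => j.
  rewrite finset.in_set0; apply/negbTE/negP => jS.
  by have := wE j; rewrite jS w0 ffunE => /esym/eqP; rewrite (negPf (sn0 _)).
exists (cell c (sv c w)).
  by apply/facesP => //; exists (sv c w); split=> //; exact: realizable_sv.
apply/setP => j; rewrite phiE ?realizable_sv// wE.
by case: ifP => _; rewrite ?eqxx// sn0.
Qed.

Lemma simplicialP :
  simplicial A <-> forall s, s \in cell_signs c 4 -> #|walls c s| = 4%N.
Proof.
rewrite /simplicial chambersE//; split=> [simp s sE|W4 _ [s /= sE <-]].
  by apply: tetrahedron_card_walls => //; apply: simp; exists s.
exact/card_walls_tetrahedron/W4.
Qed.

End Tetrahedra.

Theorem proposition3p1 (R : realType) (A : seq (covec R))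
    (A_arrangement : is_arrangement A) (A_essential : essential A) :
  let f := f_vector A in
  (simplicial A <-> f 2%N = (2 * f 3%N)%N) /\
  (f 2%N = (2 * f 3%N)%N <->
    2 * (f 0%N)%:Z - 2 * (f 1%N)%:Z + (f 2%N)%:Z = 0).
Proof.
move=> f; have c_neq0 := hyperplane_neq0 A_arrangement.
have c_inj := @hyperplane_inj R A A_arrangement.
have c_ess := @hyperplane_ess R A A_essential.
have fE := f_vectorE A_essential.
rewrite simplicialP// -card_walls_eq4P//.
(* After halving, this is f0 - f1 + f2 - f3 = 0, so 2 f0 - 2 f1 + f2 equals 2 f3 - f2. *)
have := euler_cells c_ess.
rewrite -!fE -/f; move: (f 0%N) (f 1%N) (f 2%N) (f 3%N) => a b d e h.
by split; split; lia.
Qed.
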